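(* (1) If $\delta$ is a Mahlo cardinal, then there are unboundedly many $\kappa<\delta$ that are uplifting in $V_\delta$. (2) Every uplifting cardinal is pseudo uplifting and is a limit of pseudo uplifting cardinals. (3) If there is a pseudo $0$-uplifting cardinal, then there is a transitive set model of ${\rm ZFC}$ + the Lévy scheme, and consequently a transitive set model of ${\rm ZFC}+$''$\mathrm{Ord}$ is Mahlo''.
   Context: An inaccessible cardinal $\kappa$ is $\theta$-uplifting (for an ordinal $\theta$) if there is an inaccessible $\gamma\ge\theta$ with $V_\kappa\prec V_\gamma$ a proper elementary extension; $\kappa$ is uplifting if it is $\theta$-uplifting for every ordinal $\theta$. An inaccessible $\kappa$ is pseudo $\theta$-uplifting if there is a cardinal $\gamma\ge\theta$ (not necessarily inaccessible) with $V_\kappa\prec V_\gamma$ a proper elementary extension; pseudo uplifting if pseudo $\theta$-uplifting for all $\theta$. The Lévy scheme is the theory, in the language of set theory with a constant $\delta$, consisting of ''$\delta$ is inaccessible'' together with all axioms $\forall x\in V_\delta\,[\varphi(x)\leftrightarrow\varphi^{V_\delta}(x)]$. ''$\mathrm{Ord}$ is Mahlo'' is the scheme asserting that every definable closed unbounded class of ordinals contains a regular cardinal. *)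

(* Defs.v *)
(* All set-theoretic notions below are stated for an arbitrary
   structure (D, E), so that each of them can be evaluated in the universe, in
   some V_delta, or in a transitive set model (via [restr]). *)

(* Formulas of the language {∈}, with de Bruijn indices. *)
Inductive formula : Type :=
| fMem (i j : nat)
| fEq (i j : nat)
| fNot (f : formula)
| fAnd (f g : formula)
| fEx (f : formula).

Definition scons {D : Type} (x : D) (rho : nat -> D) (n : nat) : D :=
  match n with 0 => x | S m => rho m end.

(* [sat E A rho f] is the relativization f^A, evaluated at rho; when rho takes
   its values in A it says (A, E) |= f[rho]. *)
Fixpoint sat {D : Type} (E : D -> D -> Prop) (A : D -> Prop)
    (rho : nat -> D) (f : formula) : Prop :=
  match f with
  | fMem i j => E (rho i) (rho j)
  | fEq i j => rho i = rho j
  | fNot g => ~ sat E A rho g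
  | fAnd g h => sat E A rho g /\ sat E A rho h
  | fEx g => exists x, A x /\ sat E A (scons x rho) g
  end.

Section Structure.
Context {D : Type} (E : D -> D -> Prop).

Notation "x ∈ y" := (E x y) (at level 70, no associativity).
Notation "x ⊆ y" := (forall t, t ∈ x -> t ∈ y) (at level 70, no associativity).

Definition holds (rho : nat -> D) (f : formula) : Prop :=
  sat E (fun _ => True) rho f.

(* Definability is with parameters: those occurring in rho. *)
Definition definable (P : D -> Prop) : Prop :=
  exists f rho, forall x, P x <-> holds (scons x rho) f.

Definition definable2 (R : D -> D -> Prop) : Prop :=
  exists f rho, forall x y, R x y <-> holds (scons x (scons y rho)) f.

Definition is_empty (e : D) : Prop := forall x, ~ x ∈ e.
Definition is_upair (p a b : D) : Prop := forall x, x ∈ p <-> x = a \/ x = b.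
Definition is_union (u a : D) : Prop :=
  forall x, x ∈ u <-> exists y, y ∈ a /\ x ∈ y.
Definition is_power (p a : D) : Prop := forall x, x ∈ p <-> x ⊆ a.
Definition is_succ (s a : D) : Prop := forall x, x ∈ s <-> x ∈ a \/ x = a.

(* ZFC, with Separation and Replacement for the predicates in [C1] and the
   relations in [C2]. *)
Record ZFC_for (C1 : (D -> Prop) -> Prop) (C2 : (D -> D -> Prop) -> Prop) :
    Prop := {
  ax_extensionality : forall a b, (forall x, x ∈ a <-> x ∈ b) -> a = b;
  ax_foundation : forall a, (exists x, x ∈ a) ->
    exists x, x ∈ a /\ forall y, y ∈ x -> ~ y ∈ a;
  ax_pairing : forall a b, exists p, is_upair p a b;
  ax_union : forall a, exists u, is_union u a;
  ax_power : forall a, exists p, is_power p a;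
  ax_infinity : exists w, (exists e, is_empty e /\ e ∈ w) /\
    forall x, x ∈ w -> exists s, is_succ s x /\ s ∈ w;
  ax_separation : forall P, C1 P ->
    forall a, exists b, forall x, x ∈ b <-> x ∈ a /\ P x;
  ax_replacement : forall R, C2 R ->
    forall a, (forall x y z, x ∈ a -> R x y -> R x z -> y = z) ->
    exists b, forall y, y ∈ b <-> exists x, x ∈ a /\ R x y;
  ax_choice : forall a,
    (forall x, x ∈ a -> exists y, y ∈ x) ->
    (forall x y z, x ∈ a -> y ∈ a -> z ∈ x -> z ∈ y -> x = y) ->
    exists c, forall x, x ∈ a -> exists! y, y ∈ x /\ y ∈ c
}.

(* The ambient universe of sets: the schemes range over arbitrary classes. Its
   omega is therefore standard, so that satisfaction in set structures, stated
   here with [formula], agrees with satisfaction for formulas coded as sets. *)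
Definition ZFC_universe : Prop := ZFC_for (fun _ => True) (fun _ => True).

(* (D, E) |= ZFC, the first-order theory. *)
Definition ZFC_model : Prop := ZFC_for definable definable2.

Definition is_opair (p a b : D) : Prop :=
  exists s t, is_upair s a a /\ is_upair t a b /\ is_upair p s t.

Definition app (f x y : D) : Prop := exists p, is_opair p x y /\ p ∈ f.

Definition is_fun_on (f a : D) : Prop :=
  (forall p, p ∈ f -> exists x y, x ∈ a /\ is_opair p x y) /\
  (forall x, x ∈ a -> exists! y, app f x y).

Definition is_fun (f a b : D) : Prop :=
  is_fun_on f a /\ forall x y, app f x y -> y ∈ b.

Definition is_bij (f a b : D) : Prop :=
  is_fun f a b /\ forall y, y ∈ b -> exists! x, app f x y.

Definition transitive_set (a : D) : Prop :=
  forall x y, x ∈ a -> y ∈ x -> y ∈ a.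

(* Well-foundedness of ∈ on [a] is left to the axiom of foundation. *)
Definition ordinal (a : D) : Prop :=
  transitive_set a /\
  forall x y, x ∈ a -> y ∈ a -> x ∈ y \/ x = y \/ y ∈ x.

Definition ord_le (a b : D) : Prop := a ∈ b \/ a = b.

Definition limit_ordinal (a : D) : Prop :=
  ordinal a /\ ~ is_empty a /\
  forall x, x ∈ a -> exists s, is_succ s x /\ s ∈ a.

Definition is_omega (w : D) : Prop :=
  limit_ordinal w /\ forall n, n ∈ w -> ~ limit_ordinal n.

Definition cardinal (k : D) : Prop :=
  ordinal k /\ forall a, a ∈ k -> ~ exists f, is_bij f a k.

Definition regular_cardinal (k : D) : Prop :=
  cardinal k /\
  (exists w, is_omega w /\ ord_le w k) /\
  forall a f, a ∈ k -> is_fun f a k ->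
    exists b, b ∈ k /\ forall x y, app f x y -> y ∈ b.

Definition strong_limit (k : D) : Prop :=
  forall a p, a ∈ k -> is_power p a -> exists b f, b ∈ k /\ is_bij f p b.

Definition inaccessible (k : D) : Prop :=
  regular_cardinal k /\ (exists w, is_omega w /\ w ∈ k) /\ strong_limit k.

(* v = V_a, by the recursion V_b = ⋃_{c < b} P(V_c) on b <= a. *)
Definition is_V (a v : D) : Prop :=
  ordinal a /\
  exists s f, is_succ s a /\ is_fun_on f s /\
    (forall b y, app f b y ->
       forall x, x ∈ y <-> exists c z, c ∈ b /\ app f c z /\ x ⊆ z) /\
    app f a v.

Definition elementary (v w : D) : Prop :=
  v ⊆ w /\
  forall f rho, (forall i, rho i ∈ v) ->
    (sat E (fun x => x ∈ v) rho f <-> sat E (fun x => x ∈ w) rho f).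

Definition proper_V_elementary (k g : D) : Prop :=
  exists v w, is_V k v /\ is_V g w /\ elementary v w /\ v <> w.

Definition theta_uplifting (theta k : D) : Prop :=
  inaccessible k /\
  exists g, inaccessible g /\ ord_le theta g /\ proper_V_elementary k g.

Definition uplifting (k : D) : Prop :=
  inaccessible k /\ forall theta, ordinal theta -> theta_uplifting theta k.

Definition pseudo_theta_uplifting (theta k : D) : Prop :=
  inaccessible k /\
  exists g, cardinal g /\ ord_le theta g /\ proper_V_elementary k g.

Definition pseudo_uplifting (k : D) : Prop :=
  inaccessible k /\
  forall theta, ordinal theta -> pseudo_theta_uplifting theta k.

(* C is closed unbounded in B, where B is the class of all ordinals or the
   class of elements of a limit ordinal. *)
Definition club (B C : D -> Prop) : Prop :=
  (forall a, C a -> B a) /\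
  (forall a, B a -> exists c, C c /\ a ∈ c) /\
  (forall l, B l -> limit_ordinal l ->
     (forall a, a ∈ l -> exists c, C c /\ a ∈ c /\ c ∈ l) -> C l).

Definition Mahlo (d : D) : Prop :=
  inaccessible d /\
  forall C, club (fun x => x ∈ d) (fun x => x ∈ C) ->
    exists k, k ∈ C /\ regular_cardinal k.

Definition Ord_is_Mahlo : Prop :=
  forall C, definable C -> club ordinal C ->
    exists k, C k /\ regular_cardinal k.

(* The Lévy scheme in (D, E) with the constant interpreted by d; the formulas
   f do not mention the constant and may have several parameters. *)
Definition Levy_scheme (d : D) : Prop :=
  inaccessible d /\
  exists v, is_V d v /\
    forall f rho, (forall i, rho i ∈ v) ->
      (holds rho f <-> sat E (fun x => x ∈ v) rho f).

End Structure.

(* The structure (M, ∈) for a set M. *)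
Definition elt {D : Type} (E : D -> D -> Prop) (M : D) : Type := {x : D | E x M}.

Definition restr {D : Type} (E : D -> D -> Prop) (M : D) :
    elt E M -> elt E M -> Prop :=
  fun x y => E (proj1_sig x) (proj1_sig y).

(* Main.v *)
From Stdlib Require Import Classical ClassicalEpsilon FunctionalExtensionality.
From Stdlib Require Import Arith Lia Cantor.
Require Import Defs.

(* For an inaccessible k the structure V_k is again a full second-order universe,
   so every theorem about universes applies inside it; and V_l, for l a limit, is
   closed under subsets, pairs and power sets, which makes all the notions
   involved absolute. Reflection inside V_k yields unboundedly many l < k with
   V_l elementary in V_k, and each such l is a cardinal.

   (1) The l < d with V_l elementary in V_d form a club, so by Mahloness there
   are unboundedly many inaccessible ones, each elementary in all later ones.
   (2) If V_k is elementary in V_g with g inaccessible, reflection inside V_g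
   makes k pseudo uplifting there. Elementarity of V_l in V_g' is first-order
   expressible, by a family of sets of assignments passing the Tarski-Vaught
   test, hence V_k contains cardinals m that it believes to be pseudo uplifting;
   larger and larger g show that m really is.
   (3) V_g satisfies the Levy scheme with constant k, and in V_k every definable
   club extends to V_g with k as a limit point, so that V_g, and hence V_k, sees
   a regular cardinal in it. *)

(** * Formulas *)

(** Elementarity quantifies over all formulas, so it is not first-order as it stands, yet (2) has to
    move pseudo upliftingness from one level to another. Syntax is not coded inside the structures.
    A family of assignment sets need only contain one set for each genuine formula, and since the
    schemes of the ambient universe accept arbitrary classes, its omega is standard and induction on
    [formula] suffices. A second obstacle is that assignments are infinite sequences while l may
    have cofinality omega, so that an assignment in V_l need not lie in any V_c with c < l. Each
    formula is therefore restricted to the finitely many indices that it sees, which is the purpose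
    of [fbound]. In (3), g is only a cardinal, so V_g is not known to be a full second-order
    universe; that g is a limit and that V_g satisfies Replacement are both drawn from V_k by
    elementarity. *)

Fixpoint fbound (f : formula) : nat :=
  match f with
  | fMem i j => S (Nat.max i j)
  | fEq i j => S (Nat.max i j)
  | fNot g => fbound g
  | fAnd g h => Nat.max (fbound g) (fbound h)
  | fEx g => Nat.pred (fbound g)
  end.

Lemma sat_agree {D : Type} (E : D -> D -> Prop) (A : D -> Prop) (f : formula) :
  forall rho rho', (forall n, n < fbound f -> rho n = rho' n) ->
  (sat E A rho f <-> sat E A rho' f).
Proof.
  induction f as [i j|i j|g IH|g IHg h IHh|g IH]; simpl; intros rho rho' H.
  - rewrite (H i), (H j) by lia. tauto.
  - rewrite (H i), (H j) by lia. tauto.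
  - rewrite (IH rho rho' H). tauto.
  - rewrite (IHg rho rho'), (IHh rho rho') by (intros; apply H; lia). tauto.
  - assert (K : forall x, sat E A (scons x rho) g <-> sat E A (scons x rho') g).
    { intro x. apply IH. intros [|n] Hn; simpl; auto. apply H. lia. }
    split; intros [x [Hx Hs]]; exists x; split; auto; apply K; auto.
Qed.

(** A level can be read as a structure of its own, via [restr], or through relativized quantifiers.
    This lemma links the two readings; [holds_restr] and [nice_sat] are its instances. *)
Lemma sat_embed {D D' : Type} (E : D -> D -> Prop) (E' : D' -> D' -> Prop)
    (i : D' -> D) (A : D -> Prop) (A' : D' -> Prop) :
  (forall x y, i x = i y -> x = y) ->
  (forall x y, E' x y <-> E (i x) (i y)) ->
  (forall x, A x <-> exists x', i x' = x /\ A' x') ->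
  forall f rho, sat E' A' rho f <-> sat E A (fun n => i (rho n)) f.
Proof.
  intros inj He HA f.
  induction f as [j k|j k|g IH|g IHg h IHh|g IH]; simpl; intros rho.
  - apply He.
  - split; intros H; [now rewrite H|auto].
  - rewrite IH. tauto.
  - rewrite IHg, IHh. tauto.
  - assert (K : forall x', (fun n => i (scons x' rho n)) =
                      scons (i x') (fun n => i (rho n))).
    { intro x'. apply functional_extensionality. intros [|n]; reflexivity. }
    split.
    + intros [x' [H1 H2]]. exists (i x'). split.
      * apply HA. eauto.
      * apply IH in H2. now rewrite K in H2.
    + intros [x [H1 H2]]. apply HA in H1. destruct H1 as [x' [<- H1]].
      exists x'. split; auto. apply IH. now rewrite K.
Qed.

Lemma tarski_vaught {D : Type} (E : D -> D -> Prop) (A B : D -> Prop) :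
  (forall x, A x -> B x) ->
  (forall f rho, (forall n, A (rho n)) ->
     (exists x, B x /\ sat E B (scons x rho) f) ->
     exists x, A x /\ sat E B (scons x rho) f) ->
  forall f rho, (forall n, A (rho n)) -> (sat E A rho f <-> sat E B rho f).
Proof.
  intros HAB TV f.
  induction f as [j k|j k|g IH|g IHg h IHh|g IH]; simpl; intros rho Hr.
  - tauto.
  - tauto.
  - rewrite IH by auto. tauto.
  - rewrite IHg, IHh by auto. tauto.
  - assert (K : forall x, A x -> forall n, A (scons x rho n)).
    { intros x Hx [|n]; simpl; auto. }
    split.
    + intros [x [Hx H]]. exists x. split; auto. apply IH in H; auto.
    + intros H. destruct (TV g rho Hr H) as [x [Hx Hs]].
      exists x. split; auto. apply IH; auto.
Qed.

(** * Numbering of formulas *)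

Definition enc_pair (a b : nat) : nat := to_nat (a, b).

Lemma enc_pair_inj a b c d : enc_pair a b = enc_pair c d -> a = c /\ b = d.
Proof. intro H. apply (to_nat_inj (a, b) (c, d)) in H. now injection H. Qed.

(** An injective numbering lets a sequence of sets indexed by [nat] carry one bound for each formula
    in [reflect_step]. *)
Fixpoint enc (f : formula) : nat :=
  match f with
  | fMem i j => enc_pair 0 (enc_pair i j)
  | fEq i j => enc_pair 1 (enc_pair i j)
  | fNot g => enc_pair 2 (enc g)
  | fAnd g h => enc_pair 3 (enc_pair (enc g) (enc h))
  | fEx g => enc_pair 4 (enc g)
  end.

Lemma enc_inj f : forall g, enc f = enc g -> f = g.
Proof.
  induction f; intros []; simpl; intro H; apply enc_pair_inj in H;
    destruct H as [H1 H2]; try discriminate;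
    try (apply enc_pair_inj in H2; destruct H2); f_equal; auto.
Qed.

(** * First-order notions, uniformly in all structures *)

(** The formula is chosen before the structure: elementarity carries a notion between two levels
    only when the same formula defines it in both. *)
Definition fo (Phi : forall D : Type, (D -> D -> Prop) -> (nat -> D) -> Prop) :
    Prop :=
  exists f, forall D E rho, holds E rho f <-> Phi D E rho.

Lemma fo_mem i j : fo (fun D E rho => E (rho i) (rho j)).
Proof. exists (fMem i j). intros; apply iff_refl. Qed.

Lemma fo_eq i j : fo (fun D E rho => rho i = rho j).
Proof. exists (fEq i j). intros; apply iff_refl. Qed.

Lemma fo_not P : fo P -> fo (fun D E rho => ~ P D E rho).
Proof.
  intros [f Hf]. exists (fNot f). intros. unfold holds; simpl.
  rewrite <- Hf. apply iff_refl.
Qed.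

Lemma fo_and P Q : fo P -> fo Q -> fo (fun D E rho => P D E rho /\ Q D E rho).
Proof.
  intros [f Hf] [g Hg]. exists (fAnd f g). intros. unfold holds; simpl.
  rewrite <- Hf, <- Hg. apply iff_refl.
Qed.

Lemma fo_ext P Q :
  (forall D E rho, P D E rho <-> Q D E rho) -> fo P -> fo Q.
Proof.
  intros H [f Hf]. exists f. intros. rewrite Hf. apply H.
Qed.

Lemma fo_or P Q : fo P -> fo Q -> fo (fun D E rho => P D E rho \/ Q D E rho).
Proof.
  intros HP HQ. eapply fo_ext; [|apply fo_not, fo_and;
    [apply fo_not, HP | apply fo_not, HQ]].
  intros. simpl. tauto.
Qed.

Lemma fo_imp P Q :
  fo P -> fo Q -> fo (fun D E rho => P D E rho -> Q D E rho).
Proof.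
  intros HP HQ. eapply fo_ext; [|apply fo_not, fo_and;
    [apply HP | apply fo_not, HQ]].
  intros. simpl. tauto.
Qed.

Lemma fo_iff P Q :
  fo P -> fo Q -> fo (fun D E rho => P D E rho <-> Q D E rho).
Proof.
  intros HP HQ. apply fo_and; apply fo_imp; assumption.
Qed.

(** The bound object is a separate argument of [P], so that [apply] recovers the body of an
    existential by unification; in the premise it sits at index 0 and the other variables are
    shifted. *)
Lemma fo_ex (P : forall D : Type, (D -> D -> Prop) -> D -> (nat -> D) -> Prop) :
  fo (fun D E rho => P D E (rho 0) (fun n => rho (S n))) ->
  fo (fun D E rho => exists x, P D E x rho).
Proof.
  intros [f Hf]. exists (fEx f). intros. unfold holds; simpl. split.
  - intros [x [_ H]]. exists x. apply Hf in H. exact H.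
  - intros [x H]. exists x. split; auto. apply Hf. exact H.
Qed.

Lemma fo_all (P : forall D : Type, (D -> D -> Prop) -> D -> (nat -> D) -> Prop) :
  fo (fun D E rho => P D E (rho 0) (fun n => rho (S n))) ->
  fo (fun D E rho => forall x, P D E x rho).
Proof.
  intros H. apply fo_not in H.
  apply (fo_ex (fun D E x rho => ~ P D E x rho)), fo_not in H.
  revert H. apply fo_ext. intros D E rho. simpl. split.
  - intros K x. apply NNPP. intro N. apply K. exists x. exact N.
  - intros K [x N]. exact (N (K x)).
Qed.

Fixpoint ren (r : nat -> nat) (f : formula) : formula :=
  match f with
  | fMem i j => fMem (r i) (r j)
  | fEq i j => fEq (r i) (r j)
  | fNot g => fNot (ren r g)
  | fAnd g h => fAnd (ren r g) (ren r h)
  | fEx g => fEx (ren (scons 0 (fun n => S (r n))) g)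
  end.

Lemma sat_ren {D : Type} (E : D -> D -> Prop) A f : forall r rho,
  sat E A rho (ren r f) <-> sat E A (fun n => rho (r n)) f.
Proof.
  induction f as [j k|j k|g IH|g IHg h IHh|g IH]; simpl; intros r rho;
    try tauto.
  - rewrite IH. tauto.
  - rewrite IHg, IHh. tauto.
  - assert (K : forall x,
      (fun n => scons x rho (scons 0 (fun m => S (r m)) n)) =
      scons x (fun n => rho (r n))).
    { intro x. apply functional_extensionality. intros [|n]; reflexivity. }
    split; intros [x [H1 H2]]; exists x; split; auto.
    + apply IH in H2. now rewrite K in H2.
    + apply IH. now rewrite K.
Qed.

(** Places an arbitrary formula under the binders of a larger first-order statement, by renaming its
    indices. Instances of Replacement and definable clubs require this. *)
Lemma fo_holds f (r : nat -> nat) (g : forall D : Type, (nat -> D) -> nat -> D) :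
  (forall D rho n, g D rho n = rho (r n)) ->
  fo (fun D E rho => holds E (g D rho) f).
Proof.
  intro H. exists (ren r f). intros. unfold holds. rewrite sat_ren.
  replace (g D rho) with (fun n => rho (r n)); [apply iff_refl|].
  apply functional_extensionality. intro n. symmetry. apply H.
Qed.

Ltac fo_base :=
  first
    [ apply fo_mem | apply fo_eq | apply fo_iff | apply fo_and | apply fo_or
    | apply fo_not | apply fo_ex | apply fo_all | apply fo_imp ];
  cbn beta.

Lemma fo_empty i : fo (fun D E rho => is_empty E (rho i)).
Proof. unfold is_empty. repeat fo_base. Qed.
Lemma fo_upair i j k : fo (fun D E rho => is_upair E (rho i) (rho j) (rho k)).
Proof. unfold is_upair. repeat fo_base. Qed.
Lemma fo_succ i j : fo (fun D E rho => is_succ E (rho i) (rho j)).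
Proof. unfold is_succ. repeat fo_base. Qed.
Lemma fo_power i j : fo (fun D E rho => is_power E (rho i) (rho j)).
Proof. unfold is_power. repeat fo_base. Qed.

Lemma fo_opair i j k : fo (fun D E rho => is_opair E (rho i) (rho j) (rho k)).
Proof. unfold is_opair. repeat first [apply fo_upair | fo_base]. Qed.
Lemma fo_app i j k : fo (fun D E rho => app E (rho i) (rho j) (rho k)).
Proof. unfold app. repeat first [apply fo_opair | fo_base]. Qed.
Lemma fo_fun_on i j : fo (fun D E rho => is_fun_on E (rho i) (rho j)).
Proof.
  unfold is_fun_on, unique. repeat first [apply fo_opair | apply fo_app | fo_base].
Qed.
Lemma fo_fun i j k : fo (fun D E rho => is_fun E (rho i) (rho j) (rho k)).
Proof.
  unfold is_fun. repeat first [apply fo_fun_on | apply fo_app | fo_base].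
Qed.
Lemma fo_bij i j k : fo (fun D E rho => is_bij E (rho i) (rho j) (rho k)).
Proof.
  unfold is_bij, unique. repeat first [apply fo_fun | apply fo_app | fo_base].
Qed.
Lemma fo_ordinal i : fo (fun D E rho => ordinal E (rho i)).
Proof. unfold ordinal, transitive_set. repeat fo_base. Qed.
Lemma fo_limit i : fo (fun D E rho => limit_ordinal E (rho i)).
Proof.
  unfold limit_ordinal.
  repeat first [apply fo_ordinal | apply fo_empty | apply fo_succ | fo_base].
Qed.
Lemma fo_omega i : fo (fun D E rho => is_omega E (rho i)).
Proof. unfold is_omega. repeat first [apply fo_limit | fo_base]. Qed.
Lemma fo_cardinal i : fo (fun D E rho => cardinal E (rho i)).
Proof.
  unfold cardinal. repeat first [apply fo_ordinal | apply fo_bij | fo_base].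
Qed.
Lemma fo_regular i : fo (fun D E rho => regular_cardinal E (rho i)).
Proof.
  unfold regular_cardinal, ord_le.
  repeat first [apply fo_cardinal | apply fo_omega | apply fo_fun | apply fo_app
               | fo_base].
Qed.
Lemma fo_inaccessible i : fo (fun D E rho => inaccessible E (rho i)).
Proof.
  unfold inaccessible, strong_limit.
  repeat first [apply fo_regular | apply fo_omega | apply fo_power | apply fo_bij
               | fo_base].
Qed.
Lemma fo_V i j : fo (fun D E rho => is_V E (rho i) (rho j)).
Proof.
  unfold is_V.
  repeat first [apply fo_ordinal | apply fo_succ | apply fo_fun_on | apply fo_app
               | fo_base].
Qed.

(* Elementarity of v in w with formulas replaced by the sets of assignments that
   they define: S is a family of subsets of w^omega that contains the atomic
   ones, is closed under negation, conjunction and quantification, and passes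
   the Tarski-Vaught test for v. *)
Section Internal.
Context {D : Type} (E : D -> D -> Prop).

Definition is_scons (o w r' x r : D) : Prop :=
  is_fun E r' o w /\
  (forall e, is_empty E e -> app E r' e x) /\
  (forall n m y, E n o -> is_succ E m n -> app E r n y -> app E r' m y).

Definition ex_in (o w v Y r : D) : Prop :=
  exists x, E x v /\ exists r', is_scons o w r' x r /\ E r' Y.

Definition internal_elementary (v w : D) : Prop :=
  (forall x, E x v -> E x w) /\
  exists o, is_omega E o /\
  exists S,
    (forall a b, E a o -> E b o -> exists Y, E Y S /\
       forall r, is_fun E r o w ->
         (E r Y <-> exists x y, app E r a x /\ app E r b y /\ E x y)) /\
    (forall a b, E a o -> E b o -> exists Y, E Y S /\
       forall r, is_fun E r o w ->
         (E r Y <-> exists x, app E r a x /\ app E r b x)) /\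
    (forall Y, E Y S -> exists Z, E Z S /\
       forall r, is_fun E r o w -> (E r Z <-> ~ E r Y)) /\
    (forall X Y, E X S -> E Y S -> exists Z, E Z S /\
       forall r, is_fun E r o w -> (E r Z <-> E r X /\ E r Y)) /\
    (forall Y, E Y S -> exists Z, E Z S /\
       forall r, is_fun E r o w -> (E r Z <-> ex_in o w w Y r)) /\
    (forall Y r, E Y S -> is_fun E r o v -> ex_in o w w Y r -> ex_in o w v Y r).

Definition internal_pseudo_uplifting (k : D) : Prop :=
  inaccessible E k /\
  forall theta, ordinal E theta ->
    exists g, cardinal E g /\ ord_le E theta g /\
    exists v w, is_V E k v /\ is_V E g w /\ internal_elementary v w /\ v <> w.

(** [h] is the collapse of the relation [r] on [b] to its order type [o]. Being first-order, the
    existence of [o] can be reflected into a smaller level. *)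
Definition is_iso (h b r o : D) : Prop :=
  ordinal E o /\ is_bij E h b o /\
  forall x y x' y', app E h x x' -> app E h y y' ->
    (E x' y' <-> exists p, is_opair E p x y /\ E p r).

End Internal.

Lemma fo_ex_in i j k l m :
  fo (fun D E rho => ex_in E (rho i) (rho j) (rho k) (rho l) (rho m)).
Proof.
  unfold ex_in, is_scons.
  repeat first [apply fo_fun | apply fo_empty | apply fo_app | apply fo_succ
               | fo_base].
Qed.
Lemma fo_internal_elementary i j :
  fo (fun D E rho => internal_elementary E (rho i) (rho j)).
Proof.
  unfold internal_elementary.
  repeat first [apply fo_omega | apply fo_fun | apply fo_app | apply fo_ex_in
               | fo_base].
Qed.
Lemma fo_internal_pseudo_uplifting i :
  fo (fun D E rho => internal_pseudo_uplifting E (rho i)).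
Proof.
  unfold internal_pseudo_uplifting, ord_le.
  repeat first [apply fo_inaccessible | apply fo_ordinal | apply fo_cardinal
    | apply fo_V | apply fo_internal_elementary | fo_base].
Qed.
Lemma fo_iso i j k l : fo (fun D E rho => is_iso E (rho i) (rho j) (rho k) (rho l)).
Proof.
  unfold is_iso.
  repeat first [apply fo_ordinal | apply fo_bij | apply fo_app | apply fo_opair
               | fo_base].
Qed.

(** * Elementary substructures *)

Lemma elt_inj {D : Type} (E : D -> D -> Prop) (M : D) (x y : elt E M) :
  proj1_sig x = proj1_sig y -> x = y.
Proof.
  destruct x as [x Hx], y as [y Hy]. simpl. intros ->. f_equal.
  apply proof_irrelevance.
Qed.

Lemma holds_restr {D : Type} (E : D -> D -> Prop) (v : D) f
    (rho : nat -> elt E v) :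
  holds (restr E v) rho f <->
  sat E (fun x => E x v) (fun n => proj1_sig (rho n)) f.
Proof.
  apply sat_embed.
  - apply elt_inj.
  - intros; apply iff_refl.
  - intro x. split.
    + intro Hx. exists (exist (fun z => E z v) x Hx). auto.
    + intros [[x' Hx] [<- _]]. exact Hx.
Qed.

(** There are two assignments with the same underlying sets because the two structures have
    different carrier types. *)
Lemma elem_fo {D : Type} (E : D -> D -> Prop) (v w : D) Phi :
  elementary E v w -> fo Phi ->
  forall (rho : nat -> elt E v) (rho' : nat -> elt E w),
    (forall n, proj1_sig (rho n) = proj1_sig (rho' n)) ->
    (Phi _ (restr E v) rho <-> Phi _ (restr E w) rho').
Proof.
  intros [_ Hvw] [f Hf] rho rho' H. rewrite <- !Hf, !holds_restr.
  replace (fun n => proj1_sig (rho' n)) with (fun n => proj1_sig (rho n)).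
  - apply Hvw. intro n. apply (proj2_sig (rho n)).
  - apply functional_extensionality, H.
Qed.

Lemma elem_cancel {D : Type} (E : D -> D -> Prop) (u v w : D) :
  elementary E u w -> elementary E v w -> (forall x, E x u -> E x v) ->
  elementary E u v.
Proof.
  intros [H1 H2] [H3 H4] H. split; auto. intros f rho Hr.
  rewrite H2, H4 by auto. apply iff_refl.
Qed.

Fixpoint fall (n : nat) (f : formula) : formula :=
  match n with 0 => f | S m => fall m (fNot (fEx (fNot f))) end.

Definition splice {D : Type} (n : nat) (xs rho : nat -> D) (i : nat) : D :=
  if i <? n then xs i else rho (i - n).

Lemma splice_S {D : Type} n (x : D) xs rho :
  scons x (splice n xs rho) = splice (S n) (scons x xs) rho.
Proof. apply functional_extensionality. intros [|i]; reflexivity. Qed.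

Lemma sat_fall {D : Type} (E : D -> D -> Prop) (A : D -> Prop) n :
  (exists x, A x) -> forall f rho, sat E A rho (fall n f) <->
    forall xs, (forall i, A (xs i)) -> sat E A (splice n xs rho) f.
Proof.
  intros [x Hx]. induction n as [|n IH]; intros f rho.
  - simpl. assert (K : forall xs, splice 0 xs rho = rho).
    { intro xs. apply functional_extensionality. intro i. unfold splice. simpl.
      f_equal. lia. }
    split.
    + intros H xs _. now rewrite K.
    + intros H. rewrite <- (K (fun _ => x)). auto.
  - simpl. rewrite IH. simpl. split.
    + intros H xs Hxs. apply NNPP. intro N.
      apply (H (fun j => xs (S j))); auto. exists (xs 0). split; auto.
      rewrite splice_S. intro K. apply N.
      replace xs with (scons (xs 0) (fun j => xs (S j))); auto.
      apply functional_extensionality. intros [|j]; reflexivity.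
    + intros H xs Hxs [y [Hy N]]. apply N. rewrite splice_S. apply H.
      intros [|j]; simpl; auto.
Qed.

(** Elementarity only concerns parameters from [v]. Parameters in [w] outside [v] are reached by
    quantifying them away: the universal closure over [fbound f] indices has no free variable left,
    so it transfers under a constant assignment. *)
Lemma elem_valid {D : Type} (E : D -> D -> Prop) (v w : D) Phi :
  elementary E v w -> (exists x, E x v) -> fo Phi ->
  (forall rho : nat -> elt E v, Phi _ (restr E v) rho) ->
  forall rho : nat -> elt E w, Phi _ (restr E w) rho.
Proof.
  intros [Hs Hvw] [x Hx] [f Hf] H rho. apply Hf, holds_restr.
  assert (Kv : sat E (fun z => E z v) (fun _ => x) (fall (fbound f) f)).
  { apply sat_fall; eauto. intros xs Hxs.
    set (r := fun n => exist (fun z => E z v) (splice (fbound f) xs (fun _ => x) n)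
      (match (n <? fbound f) as b
         return E (if b then xs n else x) v with
       | true => Hxs n | false => Hx end)).
    specialize (H r). apply Hf, holds_restr in H. exact H. }
  apply Hvw in Kv; [|auto]. rewrite sat_fall in Kv by eauto.
  specialize (Kv (fun n => proj1_sig (rho n)) (fun n => proj2_sig (rho n))).
  revert Kv. apply sat_agree. intros n Hn. unfold splice.
  now destruct (Nat.ltb_spec n (fbound f)); [|lia].
Qed.

(** * Sets in a universe *)

Section Universe.
Context {D : Type} (E : D -> D -> Prop) (HZ : ZFC_universe E).

Local Notation "x ∈ y" := (E x y) (at level 70, no associativity).
Local Notation "x ⊆ y" := (forall t, t ∈ x -> t ∈ y)
  (at level 70, no associativity).

Lemma set_ext a b : (forall x, x ∈ a <-> x ∈ b) -> a = b.
Proof. apply HZ. Qed.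

Definition upair (a b : D) : D :=
  proj1_sig (constructive_indefinite_description _ (ax_pairing _ _ _ HZ a b)).
Lemma in_upair x a b : x ∈ upair a b <-> x = a \/ x = b.
Proof. unfold upair. destruct constructive_indefinite_description; auto. Qed.

Definition Un (a : D) : D :=
  proj1_sig (constructive_indefinite_description _ (ax_union _ _ _ HZ a)).
Lemma in_Un x a : x ∈ Un a <-> exists y, y ∈ a /\ x ∈ y.
Proof. unfold Un. destruct constructive_indefinite_description; auto. Qed.

Definition pow (a : D) : D :=
  proj1_sig (constructive_indefinite_description _ (ax_power _ _ _ HZ a)).
Lemma in_pow x a : x ∈ pow a <-> x ⊆ a.
Proof. unfold pow. destruct constructive_indefinite_description; auto. Qed.

Definition sep (P : D -> Prop) (a : D) : D :=
  proj1_sig (constructive_indefinite_description _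
    (ax_separation _ _ _ HZ P I a)).
Lemma in_sep P x a : x ∈ sep P a <-> x ∈ a /\ P x.
Proof. unfold sep. destruct constructive_indefinite_description; auto. Qed.

Lemma img_exists (F : D -> D) (a : D) :
  exists b, forall y, y ∈ b <-> exists x, x ∈ a /\ y = F x.
Proof.
  apply (ax_replacement _ _ _ HZ (fun x y => y = F x) I).
  intros; congruence.
Qed.
Definition img (F : D -> D) (a : D) : D :=
  proj1_sig (constructive_indefinite_description _ (img_exists F a)).
Lemma in_img y F a : y ∈ img F a <-> exists x, x ∈ a /\ y = F x.
Proof. unfold img. destruct constructive_indefinite_description; auto. Qed.

Definition inductive_set : D :=
  proj1_sig (constructive_indefinite_description _ (ax_infinity _ _ _ HZ)).
Definition emp : D := sep (fun _ => False) inductive_set.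
Lemma in_emp x : ~ x ∈ emp.
Proof. unfold emp. rewrite in_sep. tauto. Qed.

Definition succ (a : D) : D := Un (upair a (upair a a)).
Lemma in_succ x a : x ∈ succ a <-> x ∈ a \/ x = a.
Proof.
  unfold succ. rewrite in_Un. split.
  - intros [y [Hy Hx]]. apply in_upair in Hy. destruct Hy as [->| ->]; auto.
    apply in_upair in Hx. tauto.
  - intros [H| ->].
    + exists a. rewrite in_upair. auto.
    + exists (upair a a). rewrite !in_upair. auto.
Qed.

Definition opair (a b : D) : D := upair (upair a a) (upair a b).

Lemma is_empty_eq e : is_empty E e <-> e = emp.
Proof.
  split.
  - intro H. apply set_ext. intro x. split; intro K.
    + now apply H in K.
    + now apply in_emp in K.
  - intros ->. intro x. apply in_emp.
Qed.
Lemma is_upair_eq p a b : is_upair E p a b <-> p = upair a b.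
Proof.
  split.
  - intro H. apply set_ext. intro x. now rewrite (H x), in_upair.
  - intros ->. intro x. apply in_upair.
Qed.
Lemma is_power_eq p a : is_power E p a <-> p = pow a.
Proof.
  split.
  - intro H. apply set_ext. intro x. now rewrite (H x), in_pow.
  - intros ->. intro x. apply in_pow.
Qed.
Lemma is_succ_eq p a : is_succ E p a <-> p = succ a.
Proof.
  split.
  - intro H. apply set_ext. intro x. now rewrite (H x), in_succ.
  - intros ->. intro x. apply in_succ.
Qed.
Lemma is_opair_eq p a b : is_opair E p a b <-> p = opair a b.
Proof.
  split.
  - intros [s [t [H1 [H2 H3]]]]. apply is_upair_eq in H1, H2, H3. now subst.
  - intros ->. exists (upair a a), (upair a b). now rewrite !is_upair_eq.
Qed.

Lemma upair_inj a b c d : upair a b = upair c d ->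
  (a = c /\ b = d) \/ (a = d /\ b = c).
Proof.
  intro H. assert (K : forall x, (x = a \/ x = b) <-> (x = c \/ x = d)).
  { intro x. rewrite <- !in_upair, H. tauto. }
  pose proof (proj1 (K a) (or_introl eq_refl)).
  pose proof (proj1 (K b) (or_intror eq_refl)).
  pose proof (proj2 (K c) (or_introl eq_refl)).
  pose proof (proj2 (K d) (or_intror eq_refl)).
  intuition congruence.
Qed.

Lemma opair_inj a b c d : opair a b = opair c d -> a = c /\ b = d.
Proof.
  unfold opair. intro H. apply upair_inj in H.
  destruct H as [[H1 H2]|[H1 H2]]; apply upair_inj in H1, H2;
    intuition congruence.
Qed.

Lemma app_iff f x y : app E f x y <-> opair x y ∈ f.
Proof.
  split.
  - intros [p [Hp Hf]]. apply is_opair_eq in Hp. now subst.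
  - intro H. exists (opair x y). rewrite is_opair_eq. auto.
Qed.

Definition graph (F : D -> D) (a : D) : D := img (fun x => opair x (F x)) a.

Lemma app_graph F a x y : app E (graph F a) x y <-> x ∈ a /\ y = F x.
Proof.
  rewrite app_iff. unfold graph. rewrite in_img. split.
  - intros [z [Hz H]]. apply opair_inj in H. destruct H as [-> ->]. auto.
  - intros [H ->]. eauto.
Qed.

Lemma graph_fun_on F a : is_fun_on E (graph F a) a.
Proof.
  split.
  - intros p Hp. apply in_img in Hp. destruct Hp as [x [Hx ->]].
    exists x, (F x). rewrite is_opair_eq. auto.
  - intros x Hx. exists (F x). split.
    + apply app_graph. auto.
    + intros y Hy. apply app_graph in Hy. now destruct Hy.
Qed.

Lemma graph_fun F a b : (forall x, x ∈ a -> F x ∈ b) -> is_fun E (graph F a) a b.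
Proof.
  intro H. split; [apply graph_fun_on|]. intros x y Hy.
  apply app_graph in Hy. destruct Hy as [Hx ->]. auto.
Qed.

Lemma fun_on_ext f g a : is_fun_on E f a -> is_fun_on E g a ->
  (forall x y, app E f x y <-> app E g x y) -> f = g.
Proof.
  intros [Hf _] [Hg _] H. apply set_ext. intro p.
  split; intro Hp.
  - destruct (Hf p Hp) as [x [y [_ K]]]. apply is_opair_eq in K. subst.
    apply app_iff, H, app_iff, Hp.
  - destruct (Hg p Hp) as [x [y [_ K]]]. apply is_opair_eq in K. subst.
    apply app_iff, H, app_iff, Hp.
Qed.

Lemma fun_on_dom f a x y : is_fun_on E f a -> app E f x y -> x ∈ a.
Proof.
  intros [Hf _] H. apply app_iff in H. destruct (Hf _ H) as [x' [y' [Hx K]]].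
  apply is_opair_eq, opair_inj in K. destruct K as [-> _]. exact Hx.
Qed.

Lemma fun_on_inj f a x y z :
  is_fun_on E f a -> app E f x y -> app E f x z -> y = z.
Proof.
  intros Hf Hy Hz. pose proof (fun_on_dom _ _ _ _ Hf Hy) as Hx.
  destruct Hf as [_ Hf]. destruct (Hf x Hx) as [u [_ Hu]].
  rewrite <- (Hu y Hy). exact (Hu z Hz).
Qed.

(** Choice in the metatheory yields class functions; they may be used in forming sets, because the
    schemes of [ZFC_universe] admit every function on [D]. *)
Lemma choice_fun (R : D -> D -> Prop) :
  exists F : D -> D, forall x, (exists y, R x y) -> R x (F x).
Proof.
  exists (fun x => epsilon (inhabits emp) (R x)).
  intros x Hx. now apply epsilon_spec.
Qed.

Lemma no_self x : ~ x ∈ x.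
Proof.
  intro H. destruct (ax_foundation _ _ _ HZ (upair x x)) as [y [Hy K]].
  - exists x. apply in_upair. auto.
  - apply in_upair in Hy. assert (y = x) by tauto. subst y.
    apply (K x H). apply in_upair. auto.
Qed.

(** * The natural numbers *)

Fixpoint num (n : nat) : D :=
  match n with 0 => emp | S m => succ (num m) end.

Lemma num_lt n m : m < n -> num m ∈ num n.
Proof.
  induction n as [|n IH]; intro H; [lia|]. simpl. apply in_succ.
  destruct (Nat.eq_dec m n) as [->|]; auto. left. apply IH. lia.
Qed.

Lemma num_inj m n : num m = num n -> m = n.
Proof.
  intro H. destruct (Nat.lt_trichotomy m n) as [K|[K|K]]; auto;
    apply num_lt in K; rewrite H in K; now apply no_self in K.
Qed.

(** Separation for arbitrary classes cuts out exactly the standard numerals, so omega has no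
    nonstandard elements. *)
Definition omega : D := sep (fun x => exists n, x = num n) inductive_set.
Lemma in_omega x : x ∈ omega <-> exists n, x = num n.
Proof.
  unfold omega. rewrite in_sep. split; [tauto|]. intros [n ->].
  split; [|eauto]. unfold inductive_set.
  destruct constructive_indefinite_description as [w [[e [He Hw]] Hs]]; simpl.
  apply is_empty_eq in He. subst e. induction n as [|n IH]; auto.
  destruct (Hs _ IH) as [s [H1 H2]]. apply is_succ_eq in H1. now subst s.
Qed.

Lemma num_omega n : num n ∈ omega.
Proof. apply in_omega. eauto. Qed.

Definition unnum (x : D) : nat := epsilon (inhabits 0) (fun n => x = num n).
Lemma unnum_num n : unnum (num n) = n.
Proof.
  symmetry. apply num_inj. unfold unnum.
  apply (epsilon_spec (inhabits 0) (fun m => num n = num m)). eauto.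
Qed.

Definition rng (u : nat -> D) : D := img (fun x => u (unnum x)) omega.
Lemma in_rng y u : y ∈ rng u <-> exists n, y = u n.
Proof.
  unfold rng. rewrite in_img. split.
  - intros [x [_ H]]. eauto.
  - intros [n ->]. exists (num n). rewrite unnum_num. auto using num_omega.
Qed.

(** The range of a descending sequence is a set, as Replacement applies to any sequence, and this
    set violates Foundation. *)
Lemma mem_wf : well_founded E.
Proof.
  intro x. apply NNPP. intro H.
  destruct (choice_fun (fun x y => y ∈ x /\ ~ Acc E y)) as [F HF].
  set (u := fix u n := match n with 0 => x | S m => F (u m) end).
  assert (Hstep : forall z, ~ Acc E z -> F z ∈ z /\ ~ Acc E (F z)).
  { intros z Hz. apply HF. apply NNPP. intro N. apply Hz. constructor.
    intros y Hy. apply NNPP. intro K. apply N. eauto. }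
  assert (Hu : forall n, ~ Acc E (u n)).
  { induction n; simpl; auto. now apply Hstep. }
  destruct (ax_foundation _ _ _ HZ (rng u)) as [z [Hz K]].
  - exists x. apply in_rng. now exists 0.
  - apply in_rng in Hz. destruct Hz as [n ->].
    apply (K (u (S n))).
    + simpl. now apply Hstep.
    + apply in_rng. eauto.
Qed.

Definition mrec (g : D -> D) : D -> D :=
  Fix mem_wf (fun _ => D) (fun a rec =>
    g (img (fun y => match excluded_middle_informative (y ∈ a) with
                     | left h => rec y h
                     | right _ => emp
                     end) a)).

Lemma mrec_eq g a : mrec g a = g (img (mrec g) a).
Proof.
  unfold mrec at 1. rewrite Fix_eq.
  - f_equal. apply set_ext. intro y. rewrite !in_img.
    split; intros [x [Hx Hy]]; exists x; split; auto;
      destruct (excluded_middle_informative (x ∈ a)); tauto.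
  - intros x f h H. f_equal. f_equal. apply functional_extensionality.
    intro y. destruct (excluded_middle_informative (y ∈ x)); auto.
Qed.

(** * Ordinals and ranks *)

(** The hierarchy and the rank are total on [D], which spares side conditions; on ordinals [Vh] is
    the hierarchy of [is_V], by [is_V_iff]. *)
Definition Vh : D -> D := mrec (fun s => Un (img pow s)).
Definition rk : D -> D := mrec (fun s => Un (img succ s)).

Lemma in_Vh x a : x ∈ Vh a <-> exists c, c ∈ a /\ x ⊆ Vh c.
Proof.
  unfold Vh. rewrite mrec_eq. fold Vh. rewrite in_Un. split.
  - intros [y [Hy Hx]]. apply in_img in Hy. destruct Hy as [z [Hz ->]].
    apply in_img in Hz. destruct Hz as [c [Hc ->]]. exists c.
    split; auto. now apply in_pow.
  - intros [c [Hc Hx]]. exists (pow (Vh c)). rewrite in_pow. split; auto.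
    apply in_img. exists (Vh c). split; auto. apply in_img. eauto.
Qed.

Lemma in_rk z a : z ∈ rk a <-> exists c, c ∈ a /\ (z ∈ rk c \/ z = rk c).
Proof.
  unfold rk. rewrite mrec_eq. fold rk. rewrite in_Un. split.
  - intros [y [Hy Hx]]. apply in_img in Hy. destruct Hy as [w [Hw ->]].
    apply in_img in Hw. destruct Hw as [c [Hc ->]]. exists c.
    split; auto. now apply in_succ.
  - intros [c [Hc Hx]]. exists (succ (rk c)). rewrite in_succ. split; auto.
    apply in_img. exists (rk c). split; auto. apply in_img. eauto.
Qed.

Lemma no_cycle2 x y : x ∈ y -> ~ y ∈ x.
Proof.
  revert y. induction (mem_wf x) as [x _ IH]. intros y H K.
  exact (IH y K x K H).
Qed.

Lemma no_cycle3 x y z : x ∈ y -> y ∈ z -> ~ z ∈ x.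
Proof.
  revert y z. induction (mem_wf x) as [x _ IH]. intros y z H1 H2 H3.
  exact (IH z H3 x y H3 H1 H2).
Qed.

Lemma ord_trans a x y : ordinal E a -> x ∈ a -> y ∈ x -> y ∈ a.
Proof. intros [H _]. apply H. Qed.

Lemma ord_elem a x : ordinal E a -> x ∈ a -> ordinal E x.
Proof.
  intros [T C] Hx. split.
  - intros y z Hy Hz. assert (y ∈ a) by eauto. assert (z ∈ a) by eauto.
    destruct (C z x) as [K|[->|K]]; auto.
    + now apply no_cycle2 in Hz.
    + exfalso. exact (no_cycle3 _ _ _ K Hz Hy).
  - intros y z Hy Hz. apply C; eauto.
Qed.

Lemma ord_sub_cases a b :
  ordinal E a -> ordinal E b -> a ⊆ b -> a = b \/ a ∈ b.
Proof.
  intros Ha Hb Hab. destruct (classic (a = b)) as [|N]; auto. right.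
  set (d := sep (fun x => ~ x ∈ a) b).
  destruct (ax_foundation _ _ _ HZ d) as [z [Hz K]].
  - apply NNPP. intro M. apply N. apply set_ext. intro x. split; auto.
    intro Hx. apply NNPP. intro Nx. apply M. exists x. apply in_sep. auto.
  - apply in_sep in Hz. destruct Hz as [Hz Nz]. replace a with z; auto.
    apply set_ext. intro t. split; intro Ht.
    + apply NNPP. intro Nt. apply (K t Ht). apply in_sep. split; auto.
      eapply ord_trans; eauto.
    + destruct Hb as [Tb Cb]. destruct (Cb t z) as [|[->|M]]; auto; try tauto.
      elim Nz. eapply ord_trans; eauto.
Qed.

(** The intersection of the two ordinals is an ordinal; were it a proper part of both, it would be
    an element of both, hence of itself. *)
Lemma ord_trich a b :
  ordinal E a -> ordinal E b -> a ∈ b \/ a = b \/ b ∈ a.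
Proof.
  intros Ha Hb. set (c := sep (fun x => x ∈ b) a).
  assert (Hc : ordinal E c).
  { split.
    - intros x y Hx Hy. apply in_sep in Hx. apply in_sep.
      split; eapply ord_trans; intuition eauto.
    - intros x y Hx Hy. apply in_sep in Hx, Hy. apply Ha; tauto. }
  destruct (ord_sub_cases c a) as [H1|H1]; auto.
  { intros t Ht. apply in_sep in Ht. tauto. }
  - destruct (ord_sub_cases c b) as [H2|H2]; auto.
    { intros t Ht. apply in_sep in Ht. tauto. }
    + right; left. congruence.
    + left. congruence.
  - destruct (ord_sub_cases c b) as [H2|H2]; auto.
    { intros t Ht. apply in_sep in Ht. tauto. }
    + right; right. congruence.
    + exfalso. apply (no_self c). apply in_sep. auto.
Qed.

Lemma ord_of_ords a :
  transitive_set E a -> (forall x, x ∈ a -> ordinal E x) -> ordinal E a.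
Proof. intros T H. split; auto. intros. apply ord_trich; auto. Qed.

Lemma ord_sub_in a b c :
  ordinal E a -> ordinal E c -> b ∈ c -> a ⊆ b -> a ∈ c.
Proof.
  intros Ha Hc Hb H. assert (ordinal E b) by (eapply ord_elem; eauto).
  destruct (ord_sub_cases a b) as [->|]; auto. eapply ord_trans; eauto.
Qed.

Lemma ord_succ a : ordinal E a -> ordinal E (succ a).
Proof.
  intro H. apply ord_of_ords.
  - intros x y Hx Hy. apply in_succ in Hx. apply in_succ. left.
    destruct Hx as [Hx| ->]; auto. eapply ord_trans; eauto.
  - intros x Hx. apply in_succ in Hx. destruct Hx as [Hx| ->]; auto.
    eapply ord_elem; eauto.
Qed.

Lemma ord_Un s : (forall x, x ∈ s -> ordinal E x) -> ordinal E (Un s).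
Proof.
  intro H. apply ord_of_ords.
  - intros x y Hx Hy. apply in_Un in Hx. destruct Hx as [z [Hz Hx]].
    apply in_Un. exists z. split; auto. eapply ord_trans; eauto.
  - intros x Hx. apply in_Un in Hx. destruct Hx as [z [Hz Hx]].
    eapply ord_elem; eauto.
Qed.

Lemma rk_ord a : ordinal E (rk a).
Proof.
  induction (mem_wf a) as [a _ IH]. apply ord_of_ords.
  - intros x y Hx Hy. apply in_rk in Hx. destruct Hx as [c [Hc Hx]].
    apply in_rk. exists c. split; auto. left.
    destruct Hx as [Hx| ->]; auto. eapply ord_trans; eauto.
  - intros x Hx. apply in_rk in Hx. destruct Hx as [c [Hc [Hx| ->]]]; auto.
    eapply ord_elem; eauto.
Qed.

Lemma rk_in c a : c ∈ a -> rk c ∈ rk a.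
Proof. intro H. apply in_rk. eauto. Qed.

Lemma rk_le a x : ordinal E a -> (forall y, y ∈ x -> rk y ∈ a) -> rk x ⊆ a.
Proof.
  intros Ha H t Ht. apply in_rk in Ht. destruct Ht as [c [Hc [Ht| ->]]]; auto.
  eapply ord_trans; eauto.
Qed.

Lemma rk_sub a b : a ⊆ b -> rk a ⊆ rk b.
Proof. intro H. apply rk_le. apply rk_ord. auto using rk_in. Qed.

Lemma rk_of_ord a : ordinal E a -> rk a = a.
Proof.
  induction (mem_wf a) as [a _ IH]. intro Ha. apply set_ext. intro z.
  assert (K : forall c, c ∈ a -> rk c = c).
  { intros c Hc. apply IH; auto. eapply ord_elem; eauto. }
  rewrite in_rk. split.
  - intros [c [Hc H]]. rewrite K in H by auto.
    destruct H as [H| ->]; auto. eapply ord_trans; eauto.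
  - intro H. exists z. rewrite K; auto.
Qed.

(** This reduces the closure properties of levels to comparisons of ordinals. *)
Lemma in_Vh_rk a x : ordinal E a -> (x ∈ Vh a <-> rk x ∈ a).
Proof.
  revert x. induction (mem_wf a) as [a _ IH]. intros x Ha.
  rewrite in_Vh. split.
  - intros [c [Hc H]]. assert (Oc : ordinal E c) by (eapply ord_elem; eauto).
    apply ord_sub_in with c; auto using rk_ord. apply rk_le; auto.
    intros y Hy. apply IH; auto.
  - intro H. exists (rk x). split; auto. intros t Ht.
    apply IH; auto using rk_ord, rk_in.
Qed.

Lemma Vh_trans a x y : ordinal E a -> x ∈ Vh a -> y ∈ x -> y ∈ Vh a.
Proof.
  intros Ha Hx Hy. rewrite in_Vh_rk in *; auto.
  eapply ord_trans; eauto using rk_in.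
Qed.

Lemma Vh_sub a x y : ordinal E a -> x ∈ Vh a -> y ⊆ x -> y ∈ Vh a.
Proof.
  intros Ha Hx Hy. rewrite in_Vh_rk in *; auto.
  eapply ord_sub_in; eauto using rk_ord. now apply rk_sub.
Qed.

Lemma ord_in_Vh a x : ordinal E a -> ordinal E x -> (x ∈ Vh a <-> x ∈ a).
Proof. intros Ha Hx. rewrite in_Vh_rk, rk_of_ord; tauto. Qed.

Lemma Vh_mono a b : ordinal E a -> ordinal E b -> a ∈ b -> Vh a ∈ Vh b.
Proof. intros Ha Hb H. apply in_Vh. eauto. Qed.

Lemma Vh_incl a b : ordinal E a -> ordinal E b -> a ⊆ b -> Vh a ⊆ Vh b.
Proof. intros Ha Hb H t. rewrite !in_Vh_rk; auto. Qed.

Lemma is_V_iff a v : is_V E a v <-> ordinal E a /\ v = Vh a.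
Proof.
  split.
  - intros [Ha [s [f [Hs [Hf [Hrec Hv]]]]]]. split; auto.
    apply is_succ_eq in Hs. subst s.
    assert (K : forall b y, app E f b y -> y = Vh b).
    { intro b. induction (mem_wf b) as [b _ IH]. intros y Hy.
      apply set_ext. intro x. rewrite (Hrec b y Hy), in_Vh. split.
      - intros [c [z [Hc [Hz Hx]]]]. exists c. split; auto.
        now rewrite <- (IH c Hc z Hz).
      - intros [c [Hc Hx]]. exists c, (Vh c). split; auto. split; auto.
        assert (Hcs : c ∈ succ a).
        { eapply ord_trans; [apply ord_succ; eauto|eapply fun_on_dom; eauto|auto]. }
        destruct Hf as [_ Hf]. destruct (Hf c Hcs) as [z [Hz _]].
        now rewrite <- (IH c Hc z Hz). }
    auto.
  - intros [Ha ->]. split; auto. exists (succ a), (graph Vh (succ a)).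
    split; [now apply is_succ_eq|]. split; [apply graph_fun_on|]. split.
    + intros b y H x. apply app_graph in H. destruct H as [Hb ->].
      rewrite in_Vh. split.
      * intros [c [Hc Hx]]. exists c, (Vh c). repeat split; auto.
        apply app_graph. split; auto.
        eapply ord_trans; eauto using ord_succ.
      * intros [c [z [Hc [Hz Hx]]]]. apply app_graph in Hz.
        destruct Hz as [_ ->]. eauto.
    + apply app_graph. rewrite in_succ. auto.
Qed.

Lemma limit_succ l x : limit_ordinal E l -> x ∈ l -> succ x ∈ l.
Proof.
  intros [_ [_ H]] Hx. destruct (H x Hx) as [s [Hs K]].
  apply is_succ_eq in Hs. now subst s.
Qed.

Lemma num_ord n : ordinal E (num n).
Proof.
  induction n as [|n IH]; simpl; [|now apply ord_succ].
  split; intros x y H; now apply in_emp in H.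
Qed.

Lemma omega_limit : limit_ordinal E omega.
Proof.
  split; [|split].
  - apply ord_of_ords.
    + intros x y Hx Hy. apply in_omega in Hx. destruct Hx as [n ->].
      revert y Hy. induction n as [|n IH]; simpl; intros y Hy.
      * now apply in_emp in Hy.
      * apply in_succ in Hy. destruct Hy as [Hy| ->]; auto using num_omega.
    + intros x Hx. apply in_omega in Hx. destruct Hx as [n ->]. apply num_ord.
  - intro H. exact (H _ (num_omega 0)).
  - intros x Hx. apply in_omega in Hx. destruct Hx as [n ->].
    exists (num (S n)). split; [now apply is_succ_eq|apply num_omega].
Qed.

Lemma is_omega_iff w : is_omega E w <-> w = omega.
Proof.
  assert (K : forall n, ~ limit_ordinal E (num n)).
  { intros [|n] H.
    - destruct H as [_ [H _]]. apply H. intro x. apply in_emp.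
    - apply (no_self (num (S n))). simpl. apply limit_succ; auto.
      apply in_succ. auto. }
  split.
  - intros [Hw Hn]. destruct (ord_trich w omega) as [H|[H|H]]; auto.
    + apply Hw.
    + apply omega_limit.
    + apply in_omega in H. destruct H as [n ->]. now apply K in Hw.
    + exfalso. exact (Hn _ H omega_limit).
  - intros ->. split; [apply omega_limit|]. intros x Hx.
    apply in_omega in Hx. destruct Hx as [n ->]. apply K.
Qed.

Lemma limit_rk_upair l x y : limit_ordinal E l ->
  rk x ∈ l -> rk y ∈ l -> rk (upair x y) ∈ l.
Proof.
  intros Hl Hx Hy. pose proof (proj1 Hl) as Ol.
  destruct (ord_trich (rk x) (rk y)) as [H|[H|H]]; auto using rk_ord.
  - apply ord_sub_in with (succ (rk y)); auto using rk_ord, limit_succ.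
    apply rk_le; [now apply ord_succ, rk_ord|]. intros z Hz.
    apply in_upair in Hz. apply in_succ. destruct Hz as [->| ->]; auto.
  - apply ord_sub_in with (succ (rk y)); auto using rk_ord, limit_succ.
    apply rk_le; [now apply ord_succ, rk_ord|]. intros z Hz.
    apply in_upair in Hz. apply in_succ. destruct Hz as [->| ->]; auto.
  - apply ord_sub_in with (succ (rk x)); auto using rk_ord, limit_succ.
    apply rk_le; [now apply ord_succ, rk_ord|]. intros z Hz.
    apply in_upair in Hz. apply in_succ. destruct Hz as [->| ->]; auto.
Qed.

Lemma limit_join l x y : limit_ordinal E l -> x ∈ l -> y ∈ l ->
  exists z, z ∈ l /\ x ∈ z /\ y ∈ z.
Proof.
  intros Hl Hx Hy. pose proof (proj1 Hl) as Ol.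
  rewrite <- (rk_of_ord x) in * by (apply ord_elem with l; auto).
  rewrite <- (rk_of_ord y) in * by (apply ord_elem with l; auto).
  (* The rank of the pair serves as an upper bound, in place of a maximum followed by a
     successor. *)
  exists (rk (upair x y)). split; [now apply limit_rk_upair|].
  split; apply rk_in, in_upair; auto.
Qed.

Lemma Vh_upair l x y : limit_ordinal E l ->
  x ∈ Vh l -> y ∈ Vh l -> upair x y ∈ Vh l.
Proof.
  intros Hl. rewrite !in_Vh_rk by apply Hl. now apply limit_rk_upair.
Qed.

Lemma Vh_pow l x : limit_ordinal E l -> x ∈ Vh l -> pow x ∈ Vh l.
Proof.
  intros Hl. pose proof (proj1 Hl) as Ol. rewrite !in_Vh_rk by auto. intro Hx.
  apply ord_sub_in with (succ (rk x)); auto using rk_ord, limit_succ.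
  apply rk_le; [now apply ord_succ, rk_ord|]. intros z Hz.
  rewrite in_pow in Hz. apply in_succ.
  destruct (ord_sub_cases (rk z) (rk x)); auto using rk_ord.
  now apply rk_sub.
Qed.

Lemma Vh_Un l x : limit_ordinal E l -> x ∈ Vh l -> Un x ∈ Vh l.
Proof.
  intros Hl. pose proof (proj1 Hl) as Ol. rewrite !in_Vh_rk by auto. intro Hx.
  apply ord_sub_in with (rk x); auto using rk_ord.
  apply rk_le; [apply rk_ord|]. intros z Hz. apply in_Un in Hz.
  destruct Hz as [y [Hy Hz]].
  apply ord_trans with (rk y); auto using rk_ord, rk_in.
Qed.

(** * Absoluteness *)

(* [i] embeds E' onto a transitive class that is closed under subsets, pairs,
   power sets and unions, such as V_l for a limit ordinal l. *)
Record nice {D' : Type} (E' : D' -> D' -> Prop) (i : D' -> D) : Prop := {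
  nice_inj : forall x y, i x = i y -> x = y;
  nice_mem : forall x y, E' x y <-> i x ∈ i y;
  nice_trans : forall x y, y ∈ i x -> exists y', i y' = y;
  nice_sub : forall x y, y ⊆ i x -> exists y', i y' = y;
  nice_upair : forall x y, exists p, i p = upair (i x) (i y);
  nice_pow : forall x, exists p, i p = pow (i x);
  nice_Un : forall x, exists u, i u = Un (i x)
}.

Section Absoluteness.
Context {D' : Type} (E' : D' -> D' -> Prop) (i : D' -> D) (N : nice E' i).

Local Ltac pull x H :=
  let x' := fresh x in
  destruct (nice_trans _ _ N _ _ H) as [x' <-]; apply (nice_mem _ _ N) in H.

Lemma nice_eq x y : x = y <-> i x = i y.
Proof. split; [congruence|apply N]. Qed.

Lemma ab_sub a b : (forall x, E' x a -> E' x b) <-> i a ⊆ i b.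
Proof.
  split.
  - intros H x Hx. pull x Hx. apply (nice_mem _ _ N). auto.
  - intros H x Hx. apply (nice_mem _ _ N), H, (nice_mem _ _ N), Hx.
Qed.

Lemma ab_empty e : is_empty E' e <-> is_empty E (i e).
Proof.
  split.
  - intros H x Hx. pull x Hx. exact (H _ Hx).
  - intros H x Hx. apply (nice_mem _ _ N) in Hx. exact (H _ Hx).
Qed.

Lemma ab_upair p a b : is_upair E' p a b <-> is_upair E (i p) (i a) (i b).
Proof.
  split.
  - intros H x. split.
    + intro Hx. pull x Hx. rewrite <- !nice_eq. now apply H.
    + intros [->| ->]; apply (nice_mem _ _ N), H; auto.
  - intros H x. rewrite (nice_mem _ _ N), !nice_eq. apply H.
Qed.

Lemma ab_power p a : is_power E' p a <-> is_power E (i p) (i a).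
Proof.
  split.
  - intros H x. split.
    + intro Hx. pull x Hx. apply ab_sub, H, Hx.
    + intro Hx. destruct (nice_sub _ _ N _ _ Hx) as [x' <-].
      apply (nice_mem _ _ N), H, ab_sub, Hx.
  - intros H x. rewrite (nice_mem _ _ N), ab_sub. apply H.
Qed.

Lemma ab_succ s a : is_succ E' s a <-> is_succ E (i s) (i a).
Proof.
  split.
  - intros H x. split.
    + intro Hx. pull x Hx. rewrite <- nice_eq, <- (nice_mem _ _ N).
      now apply H.
    + intros [Hx| ->].
      * pull x Hx. apply (nice_mem _ _ N), H; auto.
      * apply (nice_mem _ _ N), H; auto.
  - intros H x. rewrite !(nice_mem _ _ N), nice_eq. apply H.
Qed.

Lemma ab_opair p a b : is_opair E' p a b <-> is_opair E (i p) (i a) (i b).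
Proof.
  split.
  - intros [s [t [H1 [H2 H3]]]]. exists (i s), (i t).
    now rewrite <- !ab_upair.
  - intros [s [t [H1 [H2 H3]]]]. apply is_upair_eq in H1, H2.
    destruct (nice_upair _ _ N a a) as [s' Hs].
    destruct (nice_upair _ _ N a b) as [t' Ht].
    exists s', t'. rewrite !ab_upair, !is_upair_eq. apply is_upair_eq in H3.
    subst. rewrite Hs, Ht. auto.
Qed.

Lemma nice_succ a : exists s, i s = succ (i a).
Proof.
  destruct (nice_upair _ _ N a a) as [s Hs].
  destruct (nice_upair _ _ N a s) as [t Ht].
  destruct (nice_Un _ _ N t) as [u Hu].
  exists u. unfold succ. congruence.
Qed.

Lemma ab_app f x y : app E' f x y <-> app E (i f) (i x) (i y).
Proof.
  split.
  - intros [p [H1 H2]]. exists (i p). now rewrite <- ab_opair, <- (nice_mem _ _ N).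
  - intros [p [H1 H2]]. pull p H2. exists p0. now rewrite ab_opair.
Qed.

Lemma app_range f x y : app E (i f) x y ->
  exists x' y', i x' = x /\ i y' = y /\ app E' f x' y'.
Proof.
  intro H. pose proof H as K. apply app_iff in H.
  destruct (nice_trans _ _ N _ _ H) as [p Hp].
  assert (H1 : upair x y ∈ i p) by (rewrite Hp; apply in_upair; auto).
  destruct (nice_trans _ _ N _ _ H1) as [q Hq].
  assert (Hx : x ∈ i q) by (rewrite Hq; apply in_upair; auto).
  assert (Hy : y ∈ i q) by (rewrite Hq; apply in_upair; auto).
  destruct (nice_trans _ _ N _ _ Hx) as [x' <-].
  destruct (nice_trans _ _ N _ _ Hy) as [y' <-].
  exists x', y'. rewrite ab_app. auto.
Qed.

Lemma ab_unique_r f x :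
  (exists! y, app E' f x y) <-> (exists! y, app E (i f) (i x) y).
Proof.
  split.
  - intros [y [H1 H2]]. exists (i y). split; [now apply ab_app|].
    intros z Hz. destruct (app_range _ _ _ Hz) as [x' [z' [Hx [<- Hz']]]].
    apply (nice_inj _ _ N) in Hx. subst. f_equal. auto.
  - intros [y [H1 H2]].
    destruct (app_range _ _ _ H1) as [x' [y' [Hx [<- Hy]]]].
    apply (nice_inj _ _ N) in Hx. subst. exists y'. split; auto.
    intros z Hz. apply (nice_inj _ _ N), H2, ab_app, Hz.
Qed.

Lemma ab_unique_l f y :
  (exists! x, app E' f x y) <-> (exists! x, app E (i f) x (i y)).
Proof.
  split.
  - intros [x [H1 H2]]. exists (i x). split; [now apply ab_app|].
    intros z Hz. destruct (app_range _ _ _ Hz) as [z' [y' [<- [Hy Hz']]]].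
    apply (nice_inj _ _ N) in Hy. subst. f_equal. auto.
  - intros [x [H1 H2]].
    destruct (app_range _ _ _ H1) as [x' [y' [<- [Hy Hx]]]].
    apply (nice_inj _ _ N) in Hy. subst. exists x'. split; auto.
    intros z Hz. apply (nice_inj _ _ N), H2, ab_app, Hz.
Qed.

Lemma ab_fun_on f a : is_fun_on E' f a <-> is_fun_on E (i f) (i a).
Proof.
  split; intros [H1 H2]; split.
  - intros p Hp. pull p Hp. destruct (H1 _ Hp) as [x [y [Hx K]]].
    exists (i x), (i y). now rewrite <- ab_opair, <- (nice_mem _ _ N).
  - intros x Hx. pull x Hx. apply ab_unique_r; auto.
  - intros p Hp. pose proof Hp as K. apply (nice_mem _ _ N) in Hp.
    destruct (H1 _ Hp) as [x [y [Hx L]]].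
    apply is_opair_eq in L. rewrite L in Hp.
    apply app_iff in Hp. destruct (app_range _ _ _ Hp) as [x' [y' [<- [<- _]]]].
    exists x', y'. now rewrite ab_opair, (nice_mem _ _ N), is_opair_eq.
  - intros x Hx. apply ab_unique_r, H2, (nice_mem _ _ N), Hx.
Qed.

Lemma ab_fun f a b : is_fun E' f a b <-> is_fun E (i f) (i a) (i b).
Proof.
  unfold is_fun. rewrite ab_fun_on. split; intros [H1 H2]; split; auto.
  - intros x y H. destruct (app_range _ _ _ H) as [x' [y' [<- [<- K]]]].
    apply (nice_mem _ _ N). eauto.
  - intros x y H. apply ab_app in H. apply (nice_mem _ _ N). eauto.
Qed.

Lemma ab_bij f a b : is_bij E' f a b <-> is_bij E (i f) (i a) (i b).
Proof.
  unfold is_bij. rewrite ab_fun. split; intros [H1 H2]; split; auto.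
  - intros y Hy. pull y Hy. apply ab_unique_l; auto.
  - intros y Hy. apply ab_unique_l, H2, (nice_mem _ _ N), Hy.
Qed.

(** A function between sets of the submodel is a subset of P(P(a ∪ b)), so the submodel has all of
    them. This makes cardinality, regularity and inaccessibility absolute in both directions. *)
Lemma fun_range f a b : is_fun E f (i a) (i b) -> exists f', i f' = f.
Proof.
  intros [[H1 _] H2]. destruct (nice_upair _ _ N a b) as [p Hp].
  destruct (nice_Un _ _ N p) as [u Hu]. destruct (nice_pow _ _ N u) as [q Hq].
  destruct (nice_pow _ _ N q) as [r Hr]. apply (nice_sub _ _ N r).
  intros t Ht. rewrite Hr, Hq, Hu, Hp, in_pow.
  destruct (H1 t Ht) as [x [y [Hx K]]]. apply is_opair_eq in K. subst t.
  apply app_iff, H2 in Ht.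
  assert (forall z, z = x \/ z = y -> z ∈ Un (upair (i a) (i b))).
  { intros z [->| ->]; apply in_Un; [exists (i a)|exists (i b)];
      rewrite in_upair; auto. }
  intros s Hs. rewrite in_pow. intros z Hz. apply in_upair in Hs.
  destruct Hs; subst s; apply in_upair in Hz; intuition.
Qed.

Lemma ab_transitive a : transitive_set E' a <-> transitive_set E (i a).
Proof.
  split.
  - intros H x y Hx Hy. pull x Hx. pull y Hy. apply (nice_mem _ _ N). eauto.
  - intros H x y. rewrite !(nice_mem _ _ N). apply H.
Qed.

Lemma ab_ordinal a : ordinal E' a <-> ordinal E (i a).
Proof.
  unfold ordinal. rewrite ab_transitive. split; intros [H1 H2]; split; auto.
  - intros x y Hx Hy. pull x Hx. pull y Hy.
    rewrite <- !(nice_mem _ _ N), <- nice_eq. auto.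
  - intros x y. rewrite !(nice_mem _ _ N), nice_eq. apply H2.
Qed.

Lemma ab_limit a : limit_ordinal E' a <-> limit_ordinal E (i a).
Proof.
  unfold limit_ordinal. rewrite ab_ordinal, ab_empty.
  split; intros [H1 [H2 H3]]; repeat split; auto; try apply H1.
  - intros x Hx. pull x Hx. destruct (H3 _ Hx) as [s [K1 K2]].
    exists (i s). now rewrite <- ab_succ, <- (nice_mem _ _ N).
  - intros x Hx. apply (nice_mem _ _ N) in Hx. destruct (H3 _ Hx) as [s [K1 K2]].
    pull s K2. exists s0. now rewrite ab_succ.
Qed.

Lemma ab_omega w : is_omega E' w <-> is_omega E (i w).
Proof.
  unfold is_omega. rewrite ab_limit. split; intros [H1 H2]; split; auto.
  - intros n Hn. pull n Hn. rewrite <- ab_limit. auto.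
  - intros n Hn. rewrite ab_limit. apply H2, (nice_mem _ _ N), Hn.
Qed.

Lemma ab_cardinal k : cardinal E' k <-> cardinal E (i k).
Proof.
  unfold cardinal. rewrite ab_ordinal. split; intros [H1 H2]; split; auto.
  - intros a Ha [f Hf]. pull a Ha. destruct (fun_range f _ _ (proj1 Hf)) as [f' <-].
    apply (H2 _ Ha). exists f'. now apply ab_bij.
  - intros a Ha [f Hf]. apply (H2 (i a)); [now apply (nice_mem _ _ N)|].
    exists (i f). now apply ab_bij.
Qed.

Lemma ab_ord_le a b : ord_le E' a b <-> ord_le E (i a) (i b).
Proof. unfold ord_le. now rewrite (nice_mem _ _ N), nice_eq. Qed.

Lemma ab_regular k : regular_cardinal E' k <-> regular_cardinal E (i k).
Proof.
  unfold regular_cardinal. rewrite ab_cardinal.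
  split; intros [H1 [H2 H3]]; repeat split; auto; try apply H1.
  - destruct H2 as [w [Hw K]]. exists (i w).
    now rewrite <- ab_omega, <- ab_ord_le.
  - intros a f Ha Hf. pull a Ha. destruct (fun_range f _ _ Hf) as [f' <-].
    apply ab_fun in Hf. destruct (H3 _ _ Ha Hf) as [b [Hb K]].
    exists (i b). split; [now apply (nice_mem _ _ N)|]. intros x y Hxy.
    destruct (app_range _ _ _ Hxy) as [x' [y' [<- [<- L]]]].
    apply (nice_mem _ _ N). eauto.
  - destruct H2 as [w [Hw K]].
    assert (exists w', i w' = w) as [w' <-].
    { destruct K as [K| ->]; eauto. apply (nice_trans _ _ N _ _ K). }
    exists w'. now rewrite ab_omega, ab_ord_le.
  - intros a f Ha Hf. apply (nice_mem _ _ N) in Ha. apply ab_fun in Hf.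
    destruct (H3 _ _ Ha Hf) as [b [Hb K]]. pull b Hb. exists b0.
    split; auto. intros x y Hxy. apply ab_app in Hxy.
    apply (nice_mem _ _ N). eauto.
Qed.

Lemma ab_strong_limit k : strong_limit E' k <-> strong_limit E (i k).
Proof.
  split; intros H a p Ha Hp.
  - pull a Ha. destruct (nice_pow _ _ N a0) as [p' Hp'].
    apply is_power_eq in Hp. rewrite <- Hp' in Hp. subst p.
    apply is_power_eq, ab_power in Hp'. destruct (H _ _ Ha Hp') as [b [f [Hb Hf]]].
    exists (i b), (i f). now rewrite <- ab_bij, <- (nice_mem _ _ N).
  - apply ab_power in Hp. apply (nice_mem _ _ N) in Ha.
    destruct (H _ _ Ha Hp) as [b [f [Hb Hf]]]. pull b Hb.
    destruct (fun_range f _ _ (proj1 Hf)) as [f' <-].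
    exists b0, f'. now rewrite ab_bij.
Qed.

Lemma ab_inaccessible k : inaccessible E' k <-> inaccessible E (i k).
Proof.
  unfold inaccessible. rewrite ab_regular, ab_strong_limit.
  split; intros [H1 [[w [H2 H3]] H4]]; (split; [auto|split; [|auto]]).
  - exists (i w). now rewrite <- ab_omega, <- (nice_mem _ _ N).
  - pull w H3. exists w0. now rewrite ab_omega.
Qed.

Lemma ab_V a v : is_V E' a v <-> is_V E (i a) (i v).
Proof.
  split.
  - intros [H1 [s [f [H2 [H3 [H4 H5]]]]]]. apply ab_ordinal in H1.
    apply ab_succ in H2. apply ab_fun_on in H3. split; auto.
    exists (i s), (i f). rewrite <- ab_app. repeat (split; auto).
    + intro Hx. destruct (app_range _ _ _ H) as [b' [y' [<- [<- K]]]].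
      pull x Hx. apply (H4 _ _ K) in Hx. destruct Hx as [c [z [L1 [L2 L3]]]].
      exists (i c), (i z). rewrite <- ab_app, <- (nice_mem _ _ N).
      repeat (split; auto). now apply ab_sub.
    + intros [c [z [L1 [L2 L3]]]].
      destruct (app_range _ _ _ H) as [b' [y' [<- [<- K]]]].
      destruct (app_range _ _ _ L2) as [c' [z' [<- [<- K']]]].
      destruct (nice_sub _ _ N _ _ L3) as [x' <-].
      apply (nice_mem _ _ N), (H4 _ _ K). exists c', z'.
      rewrite (nice_mem _ _ N), ab_sub. auto.
  - intro H. apply is_V_iff in H. destruct H as [Ha Hv].
    assert (Ha' : ordinal E' a) by now apply ab_ordinal.
    destruct (nice_succ a) as [s Hs]. destruct (nice_pow _ _ N v) as [p Hp].
    (* Every V_c with c ≤ a is a subset of V_a, so the recursion witnessing V_a is a function from a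
       + 1 to P(V_a) and already lies in the submodel. *)
    assert (Hf : is_fun E (graph Vh (succ (i a))) (i s) (i p)).
    { rewrite Hs. apply graph_fun. intros x Hx. rewrite Hp, in_pow, Hv.
      apply in_succ in Hx. destruct Hx as [Hx| ->]; auto.
      apply Vh_incl; auto. eapply ord_elem; eauto.
      intros t Ht. eapply ord_trans; eauto. }
    destruct (fun_range _ _ _ Hf) as [f Ef].
    split; auto. exists s, f. rewrite ab_succ, is_succ_eq. split; auto.
    rewrite <- Ef in Hf. apply ab_fun in Hf. split; [apply Hf|]. split.
    + intros b y Hy x. apply ab_app in Hy. rewrite Ef in Hy.
      apply app_graph in Hy. destruct Hy as [Hb Hy].
      rewrite (nice_mem _ _ N), Hy, in_Vh. split.
      * intros [c [Hc Hx]].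
        assert (Hcs : c ∈ succ (i a)).
        { eapply ord_trans; eauto using ord_succ. }
        assert (Hc' : app E (i f) c (Vh c)) by (rewrite Ef; now apply app_graph).
        destruct (app_range _ _ _ Hc') as [c' [z' [<- [Hz K]]]].
        exists c', z'. rewrite (nice_mem _ _ N), ab_sub, Hz. auto.
      * intros [c [z [Hc [Hz Hx]]]]. exists (i c). rewrite <- (nice_mem _ _ N).
        split; auto. apply ab_app in Hz. rewrite Ef in Hz. apply app_graph in Hz.
        destruct Hz as [_ <-]. now apply ab_sub.
    + rewrite ab_app, Ef. apply app_graph. rewrite in_succ. auto.
Qed.

Lemma ab_iso h b r o : is_iso E' h b r o <-> is_iso E (i h) (i b) (i r) (i o).
Proof.
  unfold is_iso. rewrite ab_ordinal, ab_bij.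
  split; intros [H1 [H2 H3]]; (split; [auto|split; [auto|]]).
  - intros x y x' y' Hx Hy. destruct (app_range _ _ _ Hx) as [u [u' [<- [<- Ku]]]].
    destruct (app_range _ _ _ Hy) as [z [z' [<- [<- Kz]]]].
    rewrite <- (nice_mem _ _ N), (H3 _ _ _ _ Ku Kz). split.
    + intros [p [K1 K2]]. exists (i p). now rewrite <- ab_opair, <- (nice_mem _ _ N).
    + intros [p [K1 K2]]. pull p K2. exists p0. now rewrite ab_opair.
  - intros x y x' y' Hx Hy. apply ab_app in Hx, Hy.
    rewrite (nice_mem _ _ N), (H3 _ _ _ _ Hx Hy). split.
    + intros [p [K1 K2]]. pull p K2. exists p0. now rewrite ab_opair.
    + intros [p [K1 K2]]. exists (i p). now rewrite <- ab_opair, <- (nice_mem _ _ N).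
Qed.

Lemma nice_env (rho : nat -> D) v : (forall n, rho n ∈ i v) ->
  exists rho', (forall n, E' (rho' n) v) /\ rho = fun n => i (rho' n).
Proof.
  intro H.
  assert (K : forall n, exists x, i x = rho n).
  { intro n. apply (nice_trans _ _ N v), H. }
  exists (fun n => proj1_sig (constructive_indefinite_description _ (K n))).
  split.
  - intro n. destruct constructive_indefinite_description as [x Hx]; simpl.
    apply (nice_mem _ _ N). now rewrite Hx.
  - apply functional_extensionality. intro n.
    now destruct constructive_indefinite_description.
Qed.

Lemma nice_sat v rho f :
  sat E' (fun x => E' x v) rho f <->
  sat E (fun x => x ∈ i v) (fun n => i (rho n)) f.
Proof.
  apply sat_embed; [apply N|apply N|]. intro x. split.
  - intro Hx. pull x Hx. eauto.
  - intros [x' [<- H]]. now apply (nice_mem _ _ N).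
Qed.

Lemma ab_elementary v w : elementary E' v w <-> elementary E (i v) (i w).
Proof.
  unfold elementary. rewrite ab_sub. split; intros [H1 H2]; split; auto.
  - intros f rho Hr. destruct (nice_env rho v Hr) as [rho' [K ->]].
    rewrite <- !nice_sat. auto.
  - intros f rho Hr. rewrite !nice_sat. apply H2. intro n.
    now apply (nice_mem _ _ N).
Qed.

Lemma proper_elementary_down k g v w :
  is_V E (i k) (i v) -> is_V E (i g) (i w) -> elementary E (i v) (i w) ->
  i v <> i w -> proper_V_elementary E' k g.
Proof.
  intros H1 H2 H3 H4. exists v, w. rewrite !ab_V, ab_elementary, nice_eq. auto.
Qed.

Lemma proper_elementary_up k g :
  proper_V_elementary E' k g -> proper_V_elementary E (i k) (i g).
Proof.
  intros [v [w H]]. exists (i v), (i w).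
  now rewrite <- !ab_V, <- ab_elementary, <- nice_eq.
Qed.

(** Replacement is a hypothesis because closure under subsets, pairs, powers and unions does not
    yield it. Separation holds for every predicate, whatever [C1] is, since all subsets are
    present. *)
Lemma nice_ZFC C1 C2 :
  (exists w, i w = omega) ->
  (forall R, C2 R ->
    forall a, (forall x y z, E' x a -> R x y -> R x z -> y = z) ->
    exists b, forall y, E' y b <-> exists x, E' x a /\ R x y) ->
  ZFC_for E' C1 C2.
Proof.
  intros [w Hw] HR. constructor; auto.
  - intros a b H. apply (nice_inj _ _ N), set_ext. intro x.
    split; intro Hx; pull x Hx; apply (nice_mem _ _ N), H, Hx.
  - intros a [x Hx]. destruct (ax_foundation _ _ _ HZ (i a)) as [z [Hz K]].
    { exists (i x). now apply (nice_mem _ _ N). }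
    pull z Hz. exists z0. split; auto. intros y Hy Hy'.
    apply (nice_mem _ _ N) in Hy, Hy'. exact (K _ Hy Hy').
  - intros a b. destruct (nice_upair _ _ N a b) as [p Hp]. exists p.
    now apply ab_upair, is_upair_eq.
  - intros a. destruct (nice_Un _ _ N a) as [u Hu]. exists u. intro x.
    rewrite (nice_mem _ _ N), Hu, in_Un. split.
    + intros [y [Hy Hx]]. pull y Hy. exists y0. split; auto.
      now apply (nice_mem _ _ N).
    + intros [y [Hy Hx]]. exists (i y). now rewrite <- !(nice_mem _ _ N).
  - intros a. destruct (nice_pow _ _ N a) as [p Hp]. exists p.
    now apply ab_power, is_power_eq.
  - exists w. split.
    + assert (He : emp ∈ i w) by (rewrite Hw; exact (num_omega 0)).
      destruct (nice_trans _ _ N _ _ He) as [e Ee]. rewrite <- Ee in He.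
      exists e. rewrite (nice_mem _ _ N), ab_empty, is_empty_eq. auto.
    + intros x Hx. apply (nice_mem _ _ N) in Hx.
      assert (Hs : succ (i x) ∈ i w).
      { rewrite Hw in *. apply limit_succ; auto. apply omega_limit. }
      destruct (nice_trans _ _ N _ _ Hs) as [s Es]. rewrite <- Es in Hs.
      exists s. rewrite ab_succ, is_succ_eq, (nice_mem _ _ N). auto.
  - intros P _ a.
    destruct (nice_sub _ _ N a (sep (fun x => exists x', i x' = x /\ P x') (i a)))
      as [b Hb].
    { intros t Ht. now apply in_sep in Ht. }
    exists b. intro x. rewrite !(nice_mem _ _ N), Hb, in_sep. split.
    + intros [H1 [x' [H2 H3]]]. apply (nice_inj _ _ N) in H2. subst. auto.
    + intros [H1 H2]. eauto.
  - intros a H1 H2. destruct (ax_choice _ _ _ HZ (i a)) as [c Hc].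
    + intros x Hx. pull x Hx. destruct (H1 _ Hx) as [y Hy]. exists (i y).
      now apply (nice_mem _ _ N).
    + intros x y z Hx Hy Hzx Hzy. pull x Hx. pull y Hy. pull z Hzx.
      apply (nice_mem _ _ N) in Hzy. f_equal. eauto.
    (* The choice set of the universe may lie outside the submodel; its trace on the union of [a] is
       inside and selects the same elements. *)
    + destruct (nice_Un _ _ N a) as [u Hu].
      destruct (nice_sub _ _ N u (sep (fun x => x ∈ c) (i u))) as [c' Hc'].
      { intros t Ht. now apply in_sep in Ht. }
      exists c'. intros x Hx. apply (nice_mem _ _ N) in Hx.
      destruct (Hc _ Hx) as [y [[K1 K2] K3]]. pose proof K1 as K1'. pull y K1'.
      exists y0. split.
      * split; auto. rewrite (nice_mem _ _ N), Hc', in_sep, Hu, in_Un. eauto.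
      * intros z [Hz1 Hz2]. apply (nice_inj _ _ N), K3.
        rewrite (nice_mem _ _ N), Hc', in_sep in Hz2.
        rewrite <- (nice_mem _ _ N). tauto.
Qed.

End Absoluteness.

Lemma Vh_nice l : limit_ordinal E l -> nice (restr E (Vh l)) (@proj1_sig _ _).
Proof.
  intro Hl. pose proof (proj1 Hl) as Ol. constructor.
  - apply elt_inj.
  - intros; apply iff_refl.
  - intros [x Hx] y Hy. simpl in *.
    now exists (exist (fun z => z ∈ Vh l) y (Vh_trans _ _ _ Ol Hx Hy)).
  - intros [x Hx] y Hy. simpl in *.
    now exists (exist (fun z => z ∈ Vh l) y (Vh_sub _ _ _ Ol Hx Hy)).
  - intros [x Hx] [y Hy]. simpl.
    now exists (exist (fun z => z ∈ Vh l) _ (Vh_upair _ _ _ Hl Hx Hy)).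
  - intros [x Hx]. simpl. now exists (exist (fun z => z ∈ Vh l) _ (Vh_pow _ _ Hl Hx)).
  - intros [x Hx]. simpl. now exists (exist (fun z => z ∈ Vh l) _ (Vh_Un _ _ Hl Hx)).
Qed.

(** * Inaccessible cardinals *)

Lemma regular_bound k b F : regular_cardinal E k -> b ∈ k ->
  (forall j, j ∈ b -> F j ∈ k) ->
  exists c, c ∈ k /\ forall j, j ∈ b -> F j ∈ c.
Proof.
  intros [_ [_ H]] Hb HF.
  destruct (H b (graph F b) Hb (graph_fun F b k HF)) as [c [Hc K]].
  exists c. split; auto. intros j Hj. apply (K j), app_graph. auto.
Qed.

Lemma regular_limit k : regular_cardinal E k -> omega ∈ k -> limit_ordinal E k.
Proof.
  intros Hk Hw. assert (Ok : ordinal E k) by apply Hk.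
  split; [|split]; auto.
  - intro H. exact (H _ Hw).
  - intros x Hx. exists (succ x). split; [now apply is_succ_eq|].
    (* A bound for the constant function x on omega is some c with x < c < k, so k has no largest
       element. *)
    destruct (regular_bound k omega (fun _ => x) Hk Hw) as [c [Hc K]]; auto.
    specialize (K _ (num_omega 0)).
    assert (Oc : ordinal E c) by (eapply ord_elem; eauto).
    apply ord_sub_in with c; auto.
    + apply ord_succ. eapply ord_elem; eauto.
    + intros t Ht. apply in_succ in Ht. destruct Ht as [Ht| ->]; auto.
      eapply ord_trans; eauto.
Qed.

Lemma inaccessible_omega k : inaccessible E k -> omega ∈ k.
Proof.
  intros [_ [[w [Hw H]] _]]. apply is_omega_iff in Hw. now subst w.
Qed.

Lemma inaccessible_limit k : inaccessible E k -> limit_ordinal E k.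
Proof.
  intro H. apply regular_limit; [apply H|now apply inaccessible_omega].
Qed.

Section Inaccessible.
Variable k : D.
Hypothesis Hk : inaccessible E k.

Let Ok : ordinal E k.
Proof. apply Hk. Qed.
Let Lk : limit_ordinal E k.
Proof. now apply inaccessible_limit. Qed.
Let Rk : regular_cardinal E k.
Proof. apply Hk. Qed.

(** Size less than [k], expressed by covering [x] with a class function on some b < k, which avoids
    cardinal arithmetic. The function may also take values outside [x]. *)
Definition small (x : D) : Prop :=
  exists b (F : D -> D), b ∈ k /\ forall y, y ∈ x -> exists j, j ∈ b /\ F j = y.

Lemma small_elem b : b ∈ k -> small b.
Proof. intro H. exists b, (fun x => x). split; eauto. Qed.

Lemma small_image x z G : small x ->
  (forall y, y ∈ z -> exists t, t ∈ x /\ G t = y) -> small z.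
Proof.
  intros [b [F [Hb HF]]] H. exists b, (fun j => G (F j)). split; auto.
  intros y Hy. destruct (H y Hy) as [t [Ht <-]].
  destruct (HF t Ht) as [j [Hj <-]]. eauto.
Qed.

Lemma small_sub x y : small x -> y ⊆ x -> small y.
Proof. intros H K. apply (small_image x y (fun t => t)); eauto. Qed.

(** A subset y of x is recovered from its preimage in b, and a bijection from P(b) to some c < k
    indexes these preimages. *)
Lemma small_pow x : small x -> small (pow x).
Proof.
  intros [b [F [Hb HF]]].
  destruct Hk as [_ [_ SL]].
  destruct (SL b (pow b) Hb) as [c [f [Hc [Hf Hf']]]]; [now apply is_power_eq|].
  destruct (choice_fun (fun j d => app E f d j)) as [G HG].
  exists c, (fun j => img F (G j)). split; auto. intros y Hy.
  rewrite in_pow in Hy. set (d := sep (fun j => F j ∈ y) b).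
  assert (Hd : d ∈ pow b).
  { rewrite in_pow. intros t Ht. now apply in_sep in Ht. }
  destruct Hf as [[Hf1 Hf2] Hf3]. destruct (Hf2 d Hd) as [j [Hj _]].
  exists j. split; [eauto|].
  replace (G j) with d.
  - apply set_ext. intro t. rewrite in_img. split.
    + intros [s [Hs ->]]. now apply in_sep in Hs.
    + intro Ht. destruct (HF t (Hy t Ht)) as [s [Hs <-]]. exists s.
      split; auto. apply in_sep. auto.
  - destruct (Hf' j (Hf3 _ _ Hj)) as [d' [_ U]].
    rewrite <- (U d Hj). apply U, HG. eauto.
Qed.

(* Pairs from m are elements of P(P(m)), so that strong limits make cardinal
   multiplication unnecessary. *)
Lemma small_family b x (G : D -> D) : b ∈ k ->
  (forall j, j ∈ b -> small (G j)) ->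
  (forall y, y ∈ x -> exists j, j ∈ b /\ y ∈ G j) -> small x.
Proof.
  intros Hb HG Hx.
  destruct (choice_fun (fun j c => c ∈ k /\ exists F : D -> D,
    forall y, y ∈ G j -> exists t, t ∈ c /\ F t = y)) as [B HB].
  assert (HB' : forall j, j ∈ b -> B j ∈ k /\ exists F : D -> D,
    forall y, y ∈ G j -> exists t, t ∈ B j /\ F t = y).
  { intros j Hj. apply HB. destruct (HG j Hj) as [c [F [Hc HF]]]. eauto. }
  (* The enumerations to be chosen are functions on [D], whereas [choice_fun] selects elements of
     [D]; hence [epsilon] is used directly. *)
  set (Fs := fun j => epsilon (inhabits (fun x : D => x)) (fun F : D -> D =>
    forall y, y ∈ G j -> exists t, t ∈ B j /\ F t = y)).
  assert (HFs : forall j, j ∈ b ->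
    forall y, y ∈ G j -> exists t, t ∈ B j /\ Fs j t = y).
  { intros j Hj. destruct (HB' j Hj) as [_ H]. unfold Fs.
    now apply (epsilon_spec (inhabits (fun x : D => x)) (fun F : D -> D =>
      forall y, y ∈ G j -> exists t, t ∈ B j /\ F t = y)). }
  destruct (regular_bound k b B Rk Hb) as [c [Hc HBc]].
  { intros j Hj. now apply HB'. }
  assert (Oc : ordinal E c) by (eapply ord_elem; eauto).
  assert (Ob : ordinal E b) by (apply ord_elem with k; auto).
  assert (exists m, m ∈ k /\ b ⊆ m /\ c ⊆ m) as [m [Hm [Hbm Hcm]]].
  { destruct (ord_trich b c) as [H|[H|H]]; auto.
    - exists c. repeat split; auto. intros t Ht. eapply ord_trans; eauto.
    - subst c. eauto.
    - exists b. repeat split; auto. intros t Ht. eapply ord_trans; eauto. }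
  destruct (choice_fun (fun p y => exists j t, p = opair j t /\ y = Fs j t))
    as [H HH].
  apply (small_image (pow (pow m)) x H).
  - now apply small_pow, small_pow, small_elem.
  - intros y Hy. destruct (Hx y Hy) as [j [Hj Hyj]].
    destruct (HFs j Hj y Hyj) as [t [Ht <-]]. exists (opair j t). split.
    + assert (Ht' : t ∈ m).
      { apply Hcm. eapply ord_trans; eauto. }
      rewrite in_pow. intros s Hs. rewrite in_pow. intros z Hz.
      apply in_upair in Hs. destruct Hs; subst s; apply in_upair in Hz;
        destruct Hz; subst z; auto.
    + destruct (HH (opair j t)) as [j' [t' [K1 K2]]]; eauto.
      apply opair_inj in K1. destruct K1. now subst.
Qed.

Lemma Vh_small a : a ∈ k -> small (Vh a).
Proof.
  induction (mem_wf a) as [a _ IH]. intro Ha.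
  apply (small_family a _ (fun c => pow (Vh c))); auto.
  - intros j Hj. apply small_pow, IH; auto. eapply ord_trans; eauto.
  - intros y Hy. apply in_Vh in Hy. destruct Hy as [c [Hc Hy]]. exists c.
    rewrite in_pow. auto.
Qed.

Lemma Vh_elem_small x : x ∈ Vh k -> small x.
Proof.
  intro H. apply in_Vh in H. destruct H as [c [Hc H]].
  eapply small_sub; eauto. now apply Vh_small.
Qed.

Lemma small_bound x F : small x -> (forall y, y ∈ x -> F y ∈ Vh k) ->
  exists c, c ∈ k /\ forall y, y ∈ x -> F y ∈ Vh c.
Proof.
  intros [b [G [Hb HG]]] HF.
  (* Some [G j] may fall outside [x], where [F] is not known to land in V_k; omega is a harmless
     default below [k] there. *)
  destruct (regular_bound k b (fun j =>
    if excluded_middle_informative (rk (F (G j)) ∈ k)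
    then rk (F (G j)) else omega)) as [c [Hc H]]; auto.
  { intros j Hj. destruct excluded_middle_informative; auto.
    now apply inaccessible_omega. }
  exists c. split; auto. intros y Hy. destruct (HG y Hy) as [j [Hj <-]].
  apply in_Vh_rk; [eapply ord_elem; eauto|]. specialize (H j Hj).
  destruct excluded_middle_informative as [|n]; auto. elim n.
  apply in_Vh_rk; auto.
Qed.

(** For Replacement, an element of V_k is small, so by regularity the ranks of the values taken on
    it are bounded below [k]; this holds for arbitrary relations and gives the second-order
    scheme. *)
Lemma Vh_universe : ZFC_universe (restr E (Vh k)).
Proof.
  apply nice_ZFC with (@proj1_sig _ _).
  - now apply Vh_nice.
  - assert (H : omega ∈ Vh k).
    { apply ord_in_Vh; auto. apply omega_limit. now apply inaccessible_omega. }
    now exists (exist (fun z => z ∈ Vh k) _ H).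
  - intros R _ [a Ha] HR.
    destruct (choice_fun (fun x y => exists x' y' : elt E (Vh k),
      proj1_sig x' = x /\ proj1_sig y' = y /\ R x' y')) as [F HF].
    set (d := sep (fun x => exists x' y' : elt E (Vh k),
      proj1_sig x' = x /\ R x' y') a).
    destruct (small_bound d F) as [c [Hc Hb]].
    + apply small_sub with a; [now apply Vh_elem_small|].
      intros t Ht. now apply in_sep in Ht.
    + intros x Hx. apply in_sep in Hx. destruct Hx as [Hx [x' [y' [<- H]]]].
      destruct (HF (proj1_sig x')) as [x'' [y'' [_ [<- _]]]]; eauto 6.
      apply (proj2_sig y'').
    + assert (Oc : ordinal E c) by (eapply ord_elem; eauto).
      assert (Hi : img F d ∈ Vh k).
      { apply in_Vh. exists c. split; auto. intros t Ht. apply in_img in Ht.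
        destruct Ht as [x [Hx ->]]. auto. }
      exists (exist (fun z => z ∈ Vh k) _ Hi). intro y. unfold restr at 1. simpl.
      assert (KF : forall x y : elt E (Vh k), proj1_sig x ∈ a -> R x y ->
                     F (proj1_sig x) = proj1_sig y).
      { intros x z Hx Hxz.
        destruct (HF (proj1_sig x)) as [x'' [y'' [K1 [<- K2]]]]; eauto 6.
        apply elt_inj in K1. subst x''. f_equal. eapply HR; eauto. }
      rewrite in_img. split.
      * intros [x [Hx Hy]]. apply in_sep in Hx.
        destruct Hx as [Hx [x' [y' [<- H]]]]. exists x'. split; auto.
        rewrite (KF x' y') in Hy; auto. apply elt_inj in Hy. now subst.
      * intros [x [Hx Hxy]]. exists (proj1_sig x). split.
        -- apply in_sep. eauto.
        -- symmetry. now apply KF.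
Qed.

End Inaccessible.

(** * Assignments as sets *)

Definition code (rho : nat -> D) : D := graph (fun x => rho (unnum x)) omega.

Lemma app_code rho x y : app E (code rho) x y <-> exists n, x = num n /\ y = rho n.
Proof.
  unfold code. rewrite app_graph, in_omega. split.
  - intros [[n ->] ->]. rewrite unnum_num. eauto.
  - intros [n [-> ->]]. rewrite unnum_num. eauto.
Qed.

Lemma app_code_num rho n y : app E (code rho) (num n) y <-> y = rho n.
Proof.
  rewrite app_code. split; [|eauto].
  intros [m [H ->]]. apply num_inj in H. now subst.
Qed.

Lemma code_fun rho v : (forall n, rho n ∈ v) -> is_fun E (code rho) omega v.
Proof. intro H. apply graph_fun. auto. Qed.

Lemma code_inj rho rho' : code rho = code rho' -> rho = rho'.
Proof.
  intro H. apply functional_extensionality. intro n.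
  assert (K : app E (code rho) (num n) (rho n)) by (apply app_code; eauto).
  rewrite H in K. apply app_code in K. destruct K as [m [K1 K2]].
  apply num_inj in K1. now subst m.
Qed.

Lemma fun_code r v : is_fun E r omega v ->
  exists rho, (forall n, rho n ∈ v) /\ r = code rho.
Proof.
  intros [Hr Hv]. destruct (choice_fun (app E r)) as [F HF].
  assert (H : forall n, app E r (num n) (F (num n))).
  { intro n. apply HF. destruct (proj2 Hr _ (num_omega n)) as [y [Hy _]]. eauto. }
  exists (fun n => F (num n)). split; [eauto|].
  apply fun_on_ext with omega; auto.
  - apply graph_fun_on.
  - intros x y. rewrite app_code. split.
    + intro K. assert (Hx : x ∈ omega) by (eapply fun_on_dom; eauto).
      apply in_omega in Hx. destruct Hx as [n ->]. exists n. split; auto.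
      eapply fun_on_inj; eauto.
    + intros [n [-> ->]]. auto.
Qed.

Definition funs (v : D) : D :=
  sep (fun r => is_fun E r omega v) (pow (pow (pow (Un (upair omega v))))).

Lemma in_funs r v : r ∈ funs v <-> is_fun E r omega v.
Proof.
  unfold funs. rewrite in_sep. split; [tauto|]. intro H. split; auto.
  destruct H as [[H1 _] H2]. rewrite in_pow. intros p Hp.
  destruct (H1 p Hp) as [x [y [Hx K]]]. apply is_opair_eq in K. subst p.
  apply app_iff, H2 in Hp. rewrite in_pow. intros s Hs.
  rewrite in_pow. intros t Ht. rewrite in_Un.
  apply in_upair in Hs; destruct Hs; subst s; apply in_upair in Ht;
    destruct Ht; subst t; first [exists omega; rewrite in_upair; now auto
      | exists v; rewrite in_upair; now auto].
Qed.

(** Collection over assignments: those into [v] are coded by the elements of the set [funs v], so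
    one chosen witness for each forms a set. *)
Lemma env_collect v (P : (nat -> D) -> D -> Prop) :
  exists B, forall rho, (forall n, rho n ∈ v) -> (exists y, P rho y) ->
    exists y, y ∈ B /\ P rho y.
Proof.
  destruct (choice_fun (fun r y => exists rho, r = code rho /\ P rho y))
    as [F HF].
  exists (img F (funs v)). intros rho Hr [y Hy]. exists (F (code rho)). split.
  - apply in_img. exists (code rho). split; auto. apply in_funs.
    now apply code_fun.
  - destruct (HF (code rho)) as [rho' [K1 K2]]; eauto.
    apply code_inj in K1. now subst.
Qed.

(** * Reflection *)

(** Only an initial segment of the assignment is bounded: the ranks of all its values may be cofinal
    in [l]. *)
Lemma limit_env_bound l rho : limit_ordinal E l -> (forall n, rho n ∈ Vh l) ->
  forall N, exists c, c ∈ l /\ forall n, n <= N -> rho n ∈ Vh c.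
Proof.
  intros Hl Hr. pose proof (proj1 Hl) as Ol.
  assert (Hr' : forall n, succ (rk (rho n)) ∈ l).
  { intro n. apply limit_succ; auto. apply in_Vh_rk; auto. }
  assert (Hs : forall n, rho n ∈ Vh (succ (rk (rho n)))).
  { intro n. apply in_Vh_rk; [apply ord_succ, rk_ord|]. apply in_succ. auto. }
  induction N as [|N [c [Hc IH]]].
  - exists (succ (rk (rho 0))). split; auto. intros n Hn.
    replace n with 0 by lia. auto.
  - assert (Oc : ordinal E c) by (eapply ord_elem; eauto).
    assert (Os : ordinal E (succ (rk (rho (S N))))) by apply ord_succ, rk_ord.
    destruct (ord_trich c (succ (rk (rho (S N))))) as [H|H]; auto.
    + exists (succ (rk (rho (S N)))). split; auto. intros n Hn.
      destruct (Nat.eq_dec n (S N)) as [->|]; auto.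
      apply (Vh_incl c); auto.
      * intros t Ht. eapply ord_trans; eauto.
      * apply IH. lia.
    + exists c. split; auto. intros n Hn.
      destruct (Nat.eq_dec n (S N)) as [->|]; [|apply IH; lia].
      apply (Vh_incl (succ (rk (rho (S N))))); auto.
      destruct H as [->|H]; auto. intros t Ht. eapply ord_trans; eauto.
Qed.

(* The Tarski-Vaught test for V_l, as a formula only sees finitely many
   parameters, which lie in V_c for some c < l. *)
Lemma limit_elementary l (B : D -> Prop) : limit_ordinal E l ->
  (forall x, x ∈ Vh l -> B x) ->
  (forall f a, a ∈ l -> exists c, a ∈ c /\ c ∈ l /\
     forall rho, (forall n, rho n ∈ Vh c) ->
       (exists x, B x /\ sat E B (scons x rho) f) ->
       exists x, x ∈ Vh l /\ sat E B (scons x rho) f) ->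
  forall f rho, (forall n, rho n ∈ Vh l) ->
    (sat E (fun x => x ∈ Vh l) rho f <-> sat E B rho f).
Proof.
  intros Hl HB H. pose proof (proj1 Hl) as Ol.
  apply (tarski_vaught E (fun x => x ∈ Vh l) B HB). intros f rho Hr Hx.
  destruct (limit_env_bound l rho Hl Hr (fbound f)) as [a [Ha Ka]].
  destruct (H f a Ha) as [c [Hc [Hcl K]]].
  assert (Oc : ordinal E c) by (eapply ord_elem; eauto).
  (* Freezing the assignment from index [fbound f] on changes nothing that [f] sees and puts all its
     values into V_a. *)
  set (rho' := fun n => rho (Nat.min n (fbound f))).
  assert (Hagree : forall x, sat E B (scons x rho) f <-> sat E B (scons x rho') f).
  { intro x. apply sat_agree. intros [|n] Hn; simpl; auto. unfold rho'.
    f_equal. lia. }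
  destruct (K rho') as [x [Hx1 Hx2]].
  - intro n. apply (Vh_incl a); auto. { eapply ord_elem; eauto. }
    { intros t Ht. eapply ord_trans; eauto. }
    apply Ka. lia.
  - destruct Hx as [x [Hx1 Hx2]]. exists x. now rewrite <- Hagree.
  - exists x. now rewrite Hagree.
Qed.

(** Witnesses for all formulas are collected at once. This is possible because [holds] is a truth
    predicate of the metatheory and the schemes of the universe apply to it. *)
Lemma reflect_step b : ordinal E b -> exists c, ordinal E c /\ b ∈ c /\
  forall f rho, (forall n, rho n ∈ Vh b) ->
    (exists x, holds E (scons x rho) f) ->
    exists x, x ∈ Vh c /\ holds E (scons x rho) f.
Proof.
  intro Hb.
  set (P := fun n B => forall rho f, enc f = n -> (forall n, rho n ∈ Vh b) ->
    (exists x, holds E (scons x rho) f) ->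
    exists x, x ∈ B /\ holds E (scons x rho) f).
  assert (HP : forall n, exists B, P n B).
  { intro n. destruct (classic (exists f, enc f = n)) as [[f Hf]|K].
    - destruct (env_collect (Vh b) (fun rho x => holds E (scons x rho) f))
        as [B HB].
      exists B. intros rho g Hg Hr Hx. rewrite <- Hf in Hg. apply enc_inj in Hg.
      subst g. auto.
    - exists emp. intros rho f Hf. elim K. eauto. }
  set (u := fun n => proj1_sig (constructive_indefinite_description _ (HP n))).
  assert (Hu : forall n, P n (u n)).
  { intro n. unfold u. now destruct constructive_indefinite_description. }
  (* This rank exceeds [b] and the rank of every collecting set [u n]. *)
  exists (rk (upair b (rng u))). split; [apply rk_ord|]. split.
  - rewrite <- (rk_of_ord b) at 1 by auto. apply rk_in, in_upair. auto.
  - intros f rho Hr Hx. destruct (Hu (enc f) rho f eq_refl Hr Hx) as [x [K1 K2]].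
    exists x. split; auto. apply in_Vh_rk; [apply rk_ord|].
    assert (rk (rng u) ∈ rk (upair b (rng u))) by (apply rk_in, in_upair; auto).
    assert (rk (u (enc f)) ∈ rk (rng u)) by (apply rk_in, in_rng; eauto).
    assert (rk x ∈ rk (u (enc f))) by now apply rk_in.
    eauto 7 using ord_trans, rk_ord.
Qed.

Lemma reflection a : ordinal E a -> exists l, limit_ordinal E l /\ a ∈ l /\
  forall f rho, (forall n, rho n ∈ Vh l) ->
    (sat E (fun x => x ∈ Vh l) rho f <-> holds E rho f).
Proof.
  intro Ha.
  destruct (choice_fun (fun b c => ordinal E b -> ordinal E c /\ b ∈ c /\
    forall f rho, (forall n, rho n ∈ Vh b) ->
    (exists x, holds E (scons x rho) f) ->
    exists x, x ∈ Vh c /\ holds E (scons x rho) f)) as [F HF].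
  assert (HF' : forall b, ordinal E b -> ordinal E (F b) /\ b ∈ F b /\
    forall f rho, (forall n, rho n ∈ Vh b) ->
    (exists x, holds E (scons x rho) f) ->
    exists x, x ∈ Vh (F b) /\ holds E (scons x rho) f).
  { intros b Hb. apply HF; auto. destruct (reflect_step b Hb) as [c Hc]. eauto. }
  (* Iterating the step omega times closes off under witnesses; starting at a + 1 puts [a] below the
     supremum. *)
  clear HF. set (s := fix s n := match n with 0 => succ a | S m => F (s m) end).
  assert (Os : forall n, ordinal E (s n)).
  { induction n; simpl; [now apply ord_succ|now apply HF']. }
  assert (Hin : forall x, x ∈ Un (rng s) <-> exists n, x ∈ s n).
  { intro x. rewrite in_Un. split.
    - intros [y [Hy Hx]]. apply in_rng in Hy. destruct Hy as [n ->]. eauto.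
    - intros [n Hn]. exists (s n). rewrite in_rng. eauto. }
  assert (Hs : forall n, s n ∈ s (S n)) by (intro n; simpl; now apply HF').
  assert (Ol : ordinal E (Un (rng s))).
  { apply ord_Un. intros x Hx. apply in_rng in Hx. destruct Hx as [n ->]. auto. }
  assert (Hl : limit_ordinal E (Un (rng s))).
  { split; [auto|split].
    - intro H. apply (H a), Hin. exists 0. apply in_succ. auto.
    - intros x Hx. exists (succ x). split; [now apply is_succ_eq|].
      apply Hin in Hx. destruct Hx as [n Hn]. apply Hin. exists (S n).
      apply ord_sub_in with (s n); auto.
      + apply ord_succ, ord_elem with (s n); auto.
      + intros t Ht. apply in_succ in Ht. destruct Ht as [Ht| ->]; auto.
        apply ord_trans with x; auto. }
  exists (Un (rng s)). split; auto. split.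
  - apply Hin. exists 0. apply in_succ. auto.
  - apply limit_elementary; auto. intros f b Hb. apply Hin in Hb.
    destruct Hb as [n Hn]. exists (s n). split; auto. split.
    + apply Hin. eauto.
    + intros rho Hr [x [_ Hx]].
      destruct (HF' (s n) (Os n)) as [_ [_ K]].
      destruct (K f rho Hr (ex_intro _ x Hx)) as [y [Hy1 Hy2]].
      exists y. split; auto. apply (Vh_incl (s (S n))); auto.
      intros t Ht. apply Hin. eauto.
Qed.

(** Uniqueness of the collapse: by induction on membership, two isomorphisms of the same relation
    onto ordinals take equal values. *)
Lemma iso_sub f h b r o l : is_iso E h b r o -> is_iso E f b r l -> l ⊆ o.
Proof.
  intros [Oo [[[Hh1 Hh2] Hh3] Hh4]] [Ol [[[Hf1 Hf2] Hf3] Hf4]].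
  assert (K : forall u x w, app E h x u -> app E f x w -> u = w).
  { intro u. induction (mem_wf u) as [u _ IH]. intros x w Hu Hw.
    apply set_ext. intro t. split; intro Ht.
    - assert (Hto : t ∈ o) by (eapply ord_trans; eauto).
      destruct (Hh3 t Hto) as [y [Hy _]].
      destruct (proj2 Hf1 y (fun_on_dom _ _ _ _ Hh1 Hy)) as [s [Hs _]].
      rewrite (IH t Ht y s Hy Hs). apply (Hf4 _ _ _ _ Hs Hw).
      now apply (Hh4 _ _ _ _ Hy Hu).
    - assert (Htl : t ∈ l) by (eapply ord_trans; eauto).
      destruct (Hf3 t Htl) as [y [Hy _]].
      destruct (proj2 Hh1 y (fun_on_dom _ _ _ _ Hf1 Hy)) as [s [Hs _]].
      assert (Hsu : s ∈ u).
      { apply (Hh4 _ _ _ _ Hs Hu). now apply (Hf4 _ _ _ _ Hy Hw). }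
      now rewrite <- (IH s Hsu y t Hs Hy). }
  intros t Ht. destruct (Hf3 t Ht) as [y [Hy _]].
  destruct (proj2 Hh1 y (fun_on_dom _ _ _ _ Hf1 Hy)) as [s [Hs _]].
  rewrite <- (K s y t Hs Hy). eauto.
Qed.

(* A bijection from b < l onto l makes b a well-order of type l. The larger
   model sees that this order is isomorphic to an ordinal, so V_l contains such
   an ordinal, which must then be l itself. *)
Lemma elem_cardinal l g : limit_ordinal E l -> limit_ordinal E g -> l ∈ g ->
  elementary E (Vh l) (Vh g) -> cardinal E l.
Proof.
  intros Hl Hg Hlg Hel. pose proof (proj1 Hl) as Ol. pose proof (proj1 Hg) as Og.
  split; auto. intros b Hb [f Hf].
  set (r := sep (fun p => exists x y x' y', p = opair x y /\ app E f x x' /\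
    app E f y y' /\ x' ∈ y') (pow (pow b))).
  assert (Hiso : is_iso E f b r l).
  { split; [auto|split; [auto|]]. intros x y x' y' Hx Hy.
    pose proof (proj1 (proj1 Hf)) as Ff. split.
    - intro H. exists (opair x y). rewrite is_opair_eq. split; auto.
      apply in_sep. split; [|eauto 8].
      assert (x ∈ b) by (eapply fun_on_dom; eauto).
      assert (y ∈ b) by (eapply fun_on_dom; eauto).
      rewrite in_pow. intros s Hs. rewrite in_pow. intros z Hz.
      apply in_upair in Hs. destruct Hs; subst s; apply in_upair in Hz;
        destruct Hz; subst z; auto.
    - intros [p [Hp Hr]]. apply is_opair_eq in Hp. subst p.
      apply in_sep in Hr. destruct Hr as [_ [u [v [u' [v' [H1 [H2 [H3 H4]]]]]]]].
      apply opair_inj in H1. destruct H1; subst u v.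
      rewrite (fun_on_inj _ _ _ _ _ Ff Hx H2), (fun_on_inj _ _ _ _ _ Ff Hy H3).
      exact H4. }
  assert (Hbv : b ∈ Vh l).
  { apply ord_in_Vh; auto. apply ord_elem with l; auto. }
  assert (Hrv : r ∈ Vh l).
  { apply Vh_sub with (pow (pow b)); auto using Vh_pow.
    intros t Ht. now apply in_sep in Ht. }
  assert (Hlv : l ∈ Vh g) by now apply ord_in_Vh.
  set (b1 := exist (fun z => z ∈ Vh l) b Hbv).
  set (r1 := exist (fun z => z ∈ Vh l) r Hrv).
  set (b2 := exist (fun z => z ∈ Vh g) b (proj1 Hel b Hbv)).
  set (r2 := exist (fun z => z ∈ Vh g) r (proj1 Hel r Hrv)).
  set (l2 := exist (fun z => z ∈ Vh g) l Hlv).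
  pose proof (Vh_nice l Hl) as Nl. pose proof (Vh_nice g Hg) as Ng.
  assert (FO : fo (fun D E rho => exists o h, is_iso E h (rho 0) (rho 1) o)).
  { repeat first [apply (fo_iso 0 2 3 1) | fo_base]. }
  destruct (proj2 (elem_fo E _ _ _ Hel FO (scons b1 (fun _ => r1))
    (scons b2 (fun _ => r2)) ltac:(intros [|n]; reflexivity))) as [o [h Hh]].
  - destruct (fun_range _ _ Ng f b2 l2 (proj1 Hf)) as [f2 Ef].
    exists l2, f2. apply (ab_iso _ _ Ng). simpl. rewrite Ef. exact Hiso.
  - apply (ab_iso _ _ Nl) in Hh. simpl in Hh.
    (* The order type o found in V_l is below l, while l ⊆ o by uniqueness of the collapse; hence o
       ∈ o. *)
    apply (no_self (proj1_sig o)). apply (iso_sub _ _ _ _ _ _ Hh Hiso).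
    apply ord_in_Vh; auto. apply Hh. apply (proj2_sig o).
Qed.

Lemma elementary_proper k g :
  ordinal E k -> ordinal E g -> elementary E (Vh k) (Vh g) -> Vh k <> Vh g ->
  k ∈ g.
Proof.
  intros Hk Hg [H _] N. destruct (ord_trich k g) as [|[->|K]]; auto; try tauto.
  elim N. apply set_ext. intro x. split; auto. apply Vh_incl; auto.
  intros t Ht. eapply ord_trans; eauto.
Qed.

Lemma Vh_neq k g : ordinal E k -> ordinal E g -> k ∈ g -> Vh k <> Vh g.
Proof.
  intros Hk Hg H K. apply (no_self (Vh k)). rewrite K at 2. now apply Vh_mono.
Qed.

(** This is the closure half of the club argument. A witness needed for V_l is supplied by some V_c
    with c < l, because V_c already satisfies the existential formula. *)
Lemma chain_elementary l w : limit_ordinal E l ->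
  (forall a, a ∈ l -> exists c, a ∈ c /\ c ∈ l /\ elementary E (Vh c) w) ->
  elementary E (Vh l) w.
Proof.
  intros Hl H. pose proof (proj1 Hl) as Ol.
  assert (Hs : forall c, c ∈ l -> Vh c ⊆ Vh l).
  { intros c Hc. apply Vh_incl; auto. { apply ord_elem with l; auto. }
    intros t Ht. eapply ord_trans; eauto. }
  assert (Hlw : Vh l ⊆ w).
  { intros x Hx. apply in_Vh in Hx. destruct Hx as [a [Ha Hx]].
    destruct (H a Ha) as [c [Hc [Hcl K]]]. apply K, in_Vh. eauto. }
  split; auto.
  apply limit_elementary; auto. intros f a Ha.
  destruct (H a Ha) as [c [Hc [Hcl [_ K]]]]. exists c. repeat split; auto.
  intros rho Hr Hx. apply (K (fEx f) rho Hr) in Hx. destruct Hx as [x [Hx1 Hx2]].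
  exists x. split; [now apply (Hs c)|]. apply K; auto.
  intros [|n]; simpl; auto.
Qed.

(** * Internal elementarity *)

Lemma is_scons_code w x rho r : x ∈ w -> (forall n, rho n ∈ w) ->
  (is_scons E omega w r x (code rho) <-> r = code (scons x rho)).
Proof.
  intros Hx Hr. split.
  - intros [H1 [H2 H3]]. destruct (fun_code _ _ H1) as [rho' [Hr' ->]]. f_equal.
    assert (K : forall n y, app E (code rho') (num n) y -> rho' n = y).
    { intros n y H. apply app_code_num in H. auto. }
    apply functional_extensionality. intros [|n]; simpl; apply K.
    + apply H2. now apply is_empty_eq.
    + apply (H3 (num n)); [apply num_omega|now apply is_succ_eq|].
      apply app_code. eauto.
  - intros ->. split; [|split].
    + apply code_fun. intros [|n]; simpl; auto.
    + intros e He. apply is_empty_eq in He. subst e. apply app_code. now exists 0.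
    + intros n m y Hn Hm Hy. apply is_succ_eq in Hm. subst m. apply app_code in Hy.
      destruct Hy as [j [-> ->]]. apply app_code. now exists (S j).
Qed.

Lemma ex_in_code w v Y rho : v ⊆ w -> (forall n, rho n ∈ w) ->
  (ex_in E omega w v Y (code rho) <->
   exists x, x ∈ v /\ code (scons x rho) ∈ Y).
Proof.
  intros Hv Hr. split.
  - intros [x [Hx [r [H1 H2]]]]. apply is_scons_code in H1; auto. subst r. eauto.
  - intros [x [Hx H]]. exists x. split; auto. exists (code (scons x rho)).
    rewrite is_scons_code; auto.
Qed.

Definition represents (w Y : D) (f : formula) : Prop :=
  forall rho, (forall n, rho n ∈ w) ->
    (code rho ∈ Y <-> sat E (fun x => x ∈ w) rho f).

Definition extension (w : D) (f : formula) : D :=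
  sep (fun r => exists rho, r = code rho /\ sat E (fun x => x ∈ w) rho f) (funs w).

Lemma extension_represents w f : represents w (extension w f) f.
Proof.
  intros rho Hr. unfold extension. rewrite in_sep, in_funs. split.
  - intros [_ [rho' [H1 H2]]]. apply code_inj in H1. now subst.
  - intro H. split; [now apply code_fun|eauto].
Qed.

(** Forwards, S consists of the sets of assignments definable over [w]. Backwards, S may be larger,
    but its closure properties put a set representing each formula into it, and the internal test
    then becomes the Tarski-Vaught test. *)
Lemma internal_elementary_iff v w :
  elementary E v w <-> internal_elementary E v w.
Proof.
  split.
  - intros [Hs Hel]. split; auto. exists omega. split; [now apply is_omega_iff|].
    exists (sep (fun Y => exists f, represents w Y f) (pow (funs w))).
    assert (HS : forall f, extension w f ∈
      sep (fun Y => exists f, represents w Y f) (pow (funs w))).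
    { intro f. apply in_sep. split.
      - apply in_pow. intros t Ht. now apply in_sep in Ht.
      - exists f. apply extension_represents. }
    pose proof app_code_num as Ha.
    split; [|split; [|split; [|split; [|split]]]].
    + intros a b H1 H2. apply in_omega in H1, H2.
      destruct H1 as [n ->], H2 as [m ->]. exists (extension w (fMem n m)).
      split; auto. intros r H. apply fun_code in H. destruct H as [rho [Hr ->]].
      rewrite (extension_represents w _ rho Hr). simpl. split.
      * intro H. exists (rho n), (rho m). now rewrite !Ha.
      * intros [x [y [K1 [K2 K3]]]]. apply Ha in K1, K2. now subst.
    + intros a b H1 H2. apply in_omega in H1, H2.
      destruct H1 as [n ->], H2 as [m ->]. exists (extension w (fEq n m)).
      split; auto. intros r H. apply fun_code in H. destruct H as [rho [Hr ->]].
      rewrite (extension_represents w _ rho Hr). simpl. split.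
      * intro H. exists (rho n). now rewrite !Ha.
      * intros [x [K1 K2]]. apply Ha in K1, K2. congruence.
    + intros Y HY. apply in_sep in HY. destruct HY as [_ [f Hf]].
      exists (extension w (fNot f)). split; auto. intros r H. apply fun_code in H.
      destruct H as [rho [Hr ->]].
      now rewrite (extension_represents w _ rho Hr), (Hf rho Hr).
    + intros X Y HX HY. apply in_sep in HX, HY.
      destruct HX as [_ [f Hf]], HY as [_ [h Hh]].
      exists (extension w (fAnd f h)). split; auto. intros r H. apply fun_code in H.
      destruct H as [rho [Hr ->]].
      now rewrite (extension_represents w _ rho Hr), (Hf rho Hr), (Hh rho Hr).
    + intros Y HY. apply in_sep in HY. destruct HY as [_ [f Hf]].
      exists (extension w (fEx f)). split; auto. intros r H. apply fun_code in H.
      destruct H as [rho [Hr ->]].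
      rewrite (extension_represents w _ rho Hr), ex_in_code by auto. simpl.
      split; intros [x [H1 H2]]; exists x; split; auto; revert H2; apply Hf;
        intros [|n]; simpl; auto.
    + intros Y r HY H. apply in_sep in HY. destruct HY as [_ [f Hf]].
      apply fun_code in H. destruct H as [rho [Hr ->]].
      rewrite !ex_in_code by auto. intros [x [H1 H2]].
      assert (K : sat E (fun x => x ∈ w) rho (fEx f)).
      { exists x. split; auto. apply Hf; auto. intros [|n]; simpl; auto. }
      apply Hel in K; auto. destruct K as [y [H3 H4]]. exists y. split; auto.
      apply Hf. { intros [|n]; simpl; auto. }
      apply Hel; auto. intros [|n]; simpl; auto.
  - intros [Hs [o [Ho [S [S1 [S2 [S3 [S4 [S5 S6]]]]]]]]]. split; auto.
    apply is_omega_iff in Ho. subst o.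
    assert (K : forall f, exists Y, Y ∈ S /\ represents w Y f).
    { pose proof app_code_num as Ha. induction f as [n m|n m|f [Y [HY IH]]|f [Y [HY IHf]] h [Z [HZ' IHh]]
                     |f [Y [HY IH]]].
      - destruct (S1 _ _ (num_omega n) (num_omega m)) as [Y [HY H]].
        exists Y. split; auto. intros rho Hr. rewrite H by now apply code_fun.
        simpl. split.
        + intros [x [y [K1 [K2 K3]]]]. apply Ha in K1, K2. now subst.
        + intro K. exists (rho n), (rho m). now rewrite !Ha.
      - destruct (S2 _ _ (num_omega n) (num_omega m)) as [Y [HY H]].
        exists Y. split; auto. intros rho Hr. rewrite H by now apply code_fun.
        simpl. split.
        + intros [x [K1 K2]]. apply Ha in K1, K2. congruence.
        + intro K. exists (rho n). now rewrite !Ha.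
      - destruct (S3 _ HY) as [Z [HZ' H]]. exists Z. split; auto. intros rho Hr.
        rewrite H by now apply code_fun. simpl. now rewrite (IH rho Hr).
      - destruct (S4 _ _ HY HZ') as [W [HW H]]. exists W. split; auto.
        intros rho Hr. rewrite H by now apply code_fun. simpl.
        now rewrite (IHf rho Hr), (IHh rho Hr).
      - destruct (S5 _ HY) as [Z [HZ' H]]. exists Z. split; auto. intros rho Hr.
        rewrite H by now apply code_fun. rewrite ex_in_code by auto. simpl.
        split; intros [x [H1 H2]]; exists x; split; auto; revert H2; apply IH;
          intros [|n]; simpl; auto. }
    apply (tarski_vaught E (fun x => x ∈ v) (fun x => x ∈ w) Hs).
    intros f rho Hr [x [Hx Hxs]].
    destruct (K f) as [Y [HY HYf]].
    assert (H : ex_in E omega w v Y (code rho)).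
    { apply S6; auto. { now apply code_fun. }
      apply ex_in_code; auto. exists x. split; auto. apply HYf; auto.
      intros [|n]; simpl; auto. }
    apply ex_in_code in H; auto. destruct H as [y [Hy H]]. exists y. split; auto.
    revert H. apply HYf. intros [|n]; simpl; auto.
Qed.

Lemma internal_pseudo_uplifting_iff k :
  pseudo_uplifting E k <-> internal_pseudo_uplifting E k.
Proof.
  split.
  - intros [Hk H]. split; auto. intros theta Ht.
    destruct (H theta Ht) as [_ [g [H1 [H2 [v [w [H3 [H4 [H5 H6]]]]]]]]].
    exists g. repeat (split; auto). exists v, w.
    now rewrite <- internal_elementary_iff.
  - intros [Hk H]. split; auto. intros theta Ht. split; auto.
    destruct (H theta Ht) as [g [H1 [H2 [v [w [H3 [H4 [H5 H6]]]]]]]].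
    exists g. repeat (split; auto). exists v, w.
    now rewrite internal_elementary_iff.
Qed.

End Universe.

(** * Uplifting cardinals *)

Section Uplifting.
Context {V : Type} (mem : V -> V -> Prop) (HV : ZFC_universe mem).

Local Notation "x ∈ y" := (mem x y) (at level 70, no associativity).
Local Notation Vm := (Vh mem HV).
Local Notation mk v := (exist (fun z => z ∈ v) _).

Let Ot : forall a x y, ordinal mem a -> x ∈ a -> y ∈ x -> y ∈ a :=
  ord_trans mem.

Lemma reflect_inaccessible g a : inaccessible mem g -> a ∈ g ->
  exists l, limit_ordinal mem l /\ a ∈ l /\ l ∈ g /\
    elementary mem (Vm l) (Vm g).
Proof.
  intros Hg Ha. pose proof (Vh_universe mem HV g Hg) as HU.
  pose proof (inaccessible_limit mem HV g Hg) as Lg. pose proof (proj1 Lg) as Og.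
  pose proof (Vh_nice mem HV g Lg) as N.
  assert (Oa : ordinal mem a) by (apply (ord_elem mem HV g); auto).
  assert (Ha' : a ∈ Vm g) by now apply ord_in_Vh.
  destruct (reflection (restr mem (Vm g)) HU (mk (Vm g) Ha')) as [l [Hl [Hal Hr]]].
  { now apply (ab_ordinal _ _ _ _ N). }
  set (v := Vh (restr mem (Vm g)) HU l) in *.
  assert (HvV : is_V mem (proj1_sig l) (proj1_sig v)).
  { apply (ab_V _ HV _ _ N). apply (is_V_iff _ HU). split; auto. apply Hl. }
  apply (is_V_iff _ HV) in HvV. destruct HvV as [Ol HvV].
  exists (proj1_sig l). rewrite <- HvV. split; [|split; [exact Hal|split]].
  - now apply (ab_limit _ _ _ _ N).
  - apply (ord_in_Vh _ HV); auto. apply (proj2_sig l).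
  - split.
    + intros x Hx. apply (Vh_trans mem HV g (proj1_sig v)); auto.
      apply (proj2_sig v).
    + intros f rho Hrho. destruct (nice_env _ _ _ _ N rho v Hrho) as [rho' [K ->]].
      rewrite <- (holds_restr mem (Vm g)), <- (nice_sat _ _ _ _ N). auto.
Qed.

(** * Uplifting cardinals below a Mahlo cardinal *)

(** The strong limit property comes from elementarity: V_d has an ordinal in bijection with P(a), so
    V_k has one too, and that ordinal is below [k]. *)
Lemma elem_regular_inaccessible k d : regular_cardinal mem k -> omega mem HV ∈ k -> k ∈ d ->
  inaccessible mem d -> elementary mem (Vm k) (Vm d) -> inaccessible mem k.
Proof.
  intros Rk Hw Hkd Hd Hel. split; [auto|split].
  { exists (omega mem HV). split; auto. now apply (is_omega_iff mem HV). }
  pose proof (regular_limit mem HV k Rk Hw) as Lk.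
  pose proof (inaccessible_limit mem HV d Hd) as Ld.
  pose proof (Vh_nice mem HV k Lk) as Nk. pose proof (Vh_nice mem HV d Ld) as Nd.
  pose proof (proj1 Lk) as Ok. pose proof (proj1 Ld) as Od.
  intros a p Ha Hp.
  assert (Hpk : p ∈ Vm k).
  { apply (is_power_eq mem HV) in Hp. subst p. apply Vh_pow; auto.
    apply ord_in_Vh; auto. apply (ord_elem mem HV k); auto. }
  destruct Hd as [_ [_ SL]].
  destruct (SL a p (ord_trans _ _ _ _ Od Hkd Ha) Hp) as [b [f [Hb Hf]]].
  assert (Ob : ordinal mem b) by (apply (ord_elem mem HV d); auto).
  assert (Hbd : b ∈ Vm d) by now apply ord_in_Vh.
  set (p1 := mk (Vm k) Hpk). set (p2 := mk (Vm d) (proj1 Hel p Hpk)).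
  assert (FO : fo (fun D E rho => exists b f, ordinal E b /\ is_bij E f (rho 0) b)).
  { repeat first [apply fo_ordinal | apply fo_bij | fo_base]. }
  destruct (proj2 (elem_fo mem _ _ _ Hel FO (fun _ => p1) (fun _ => p2)
    (fun _ => eq_refl))) as [b' [f' [H1 H2]]].
  - destruct (fun_range _ _ _ _ Nd f p2 (mk (Vm d) Hbd) (proj1 Hf)) as [f2 Ef].
    exists (mk (Vm d) Hbd), f2. rewrite (ab_ordinal _ _ _ _ Nd), (ab_bij _ _ _ _ Nd).
    simpl. now rewrite Ef.
  - rewrite (ab_ordinal _ _ _ _ Nk) in H1. rewrite (ab_bij _ _ _ _ Nk) in H2.
    exists (proj1_sig b'), (proj1_sig f'). split; auto.
    apply (ord_in_Vh mem HV k); auto. apply (proj2_sig b').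
Qed.

Lemma Mahlo_reflecting d a : Mahlo mem d -> a ∈ d ->
  exists k, k ∈ d /\ a ∈ k /\ inaccessible mem k /\
    elementary mem (Vm k) (Vm d).
Proof.
  intros [Hd HM] Ha. pose proof (inaccessible_limit mem HV d Hd) as Ld.
  pose proof (proj1 Ld) as Od. pose proof (inaccessible_omega mem HV d Hd) as Hw.
  (* The first two clauses place the regular cardinal to be found above [a] and make it
     uncountable. *)
  set (P := fun c => a ∈ c /\ omega mem HV ∈ c /\ elementary mem (Vm c) (Vm d)).
  destruct (HM (sep mem HV P d)) as [k [HkC Rk]].
  - split; [|split].
    + intros x Hx. now apply in_sep in Hx.
    + intros b Hb.
      destruct (limit_join mem HV d a (omega mem HV) Ld Ha Hw) as [e [He [H1 H2]]].
      destruct (limit_join mem HV d b e Ld Hb He) as [e' [He' [H3 H4]]].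
      destruct (reflect_inaccessible d e' Hd He') as [l [Ll [Hel [Hld El]]]].
      pose proof (proj1 Ll) as Ol.
      exists l. rewrite in_sep. unfold P. eauto 10 using Ot.
    + intros l Hl Ll HC. pose proof (proj1 Ll) as Ol. apply in_sep. split; auto.
      pose proof (proj1 (proj2 Ll)) as Hne.
      (* One point of the club below [l] already exceeds [a] and omega, hence so does [l]. *)
      apply not_all_not_ex in Hne. destruct Hne as [x Hx].
      destruct (HC x Hx) as [c [Hc [_ Hcl]]]. apply in_sep in Hc.
      destruct Hc as [_ [H1 [H2 _]]].
      split; [eauto using Ot|split; [eauto using Ot|]].
      apply chain_elementary; auto. intros y Hy.
      destruct (HC y Hy) as [c' [Hc' [Hyc Hcl']]]. apply in_sep in Hc'.
      destruct Hc' as [_ [_ [_ H3]]]. eauto.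
  - apply in_sep in HkC. destruct HkC as [Hk [H1 [H2 H3]]].
    exists k. split; [auto|split; [auto|split; [|auto]]].
    apply elem_regular_inaccessible with d; auto.
Qed.

Lemma elementary_below k l g : ordinal mem k -> ordinal mem l -> k ∈ l ->
  elementary mem (Vm k) (Vm g) -> elementary mem (Vm l) (Vm g) ->
  elementary mem (Vm k) (Vm l).
Proof.
  intros Ok Ol Hkl H1 H2. apply elem_cancel with (Vm g); auto.
  apply Vh_incl; auto. intros t Ht. eauto using Ot.
Qed.

Lemma proper_elementary_restr g k l (Hk : k ∈ Vm g) (Hl : l ∈ Vm g) :
  limit_ordinal mem g -> ordinal mem k -> ordinal mem l -> k ∈ l ->
  elementary mem (Vm k) (Vm l) ->
  proper_V_elementary (restr mem (Vm g)) (mk (Vm g) Hk) (mk (Vm g) Hl).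
Proof.
  intros Lg Ok Ol Hkl Hel. pose proof (proj1 Lg) as Og.
  assert (Hk' : Vm k ∈ Vm g).
  { apply Vh_mono; auto. now apply (ord_in_Vh mem HV g k). }
  assert (Hl' : Vm l ∈ Vm g).
  { apply Vh_mono; auto. now apply (ord_in_Vh mem HV g l). }
  apply (proper_elementary_down _ HV _ _ (Vh_nice mem HV g Lg) _ _
    (mk (Vm g) Hk') (mk (Vm g) Hl')); simpl; auto.
  - apply (is_V_iff mem HV). auto.
  - apply (is_V_iff mem HV). auto.
  - apply Vh_neq; auto.
Qed.

Lemma Mahlo_uplifting d a : Mahlo mem d -> a ∈ d ->
  exists k : elt mem (Vm d), proj1_sig k ∈ d /\ a ∈ proj1_sig k /\
    uplifting (restr mem (Vm d)) k.
Proof.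
  intros Md Ha. pose proof (inaccessible_limit mem HV d (proj1 Md)) as Ld.
  pose proof (proj1 Ld) as Od. pose proof (Vh_nice mem HV d Ld) as N.
  destruct (Mahlo_reflecting d a Md Ha) as [k [Hkd [Hak [Hk Hel]]]].
  assert (Ok : ordinal mem k) by apply Hk.
  assert (Hkv : k ∈ Vm d) by now apply ord_in_Vh.
  exists (mk (Vm d) Hkv). split; [exact Hkd|]. split; [exact Hak|].
  assert (Ik : inaccessible (restr mem (Vm d)) (mk (Vm d) Hkv))
    by now apply (ab_inaccessible _ HV _ _ N).
  split; auto. intros theta Ht. split; auto.
  apply (ab_ordinal _ _ _ _ N) in Ht.
  assert (Htd : proj1_sig theta ∈ d).
  { apply (ord_in_Vh mem HV); auto. apply (proj2_sig theta). }
  destruct (limit_join mem HV d _ _ Ld Hkd Htd) as [e [He [Hke Hte]]].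
  destruct (Mahlo_reflecting d e Md He) as [l [Hld [Hel' [Hl Hell]]]].
  assert (Ol : ordinal mem l) by apply Hl.
  assert (Hlv : l ∈ Vm d) by now apply ord_in_Vh.
  exists (mk (Vm d) Hlv). split; [now apply (ab_inaccessible _ HV _ _ N)|].
  split.
  - left. unfold restr. simpl. eauto using Ot.
  - assert (k ∈ l) by eauto using Ot.
    apply proper_elementary_restr; auto. apply elementary_below with d; auto.
Qed.

(** * Pseudo uplifting cardinals below an uplifting one *)

Lemma uplifting_above k theta : uplifting mem k -> ordinal mem theta ->
  exists g, inaccessible mem g /\ k ∈ g /\ theta ∈ g /\
    elementary mem (Vm k) (Vm g).
Proof.
  intros [Hk H] Ht. assert (Ok : ordinal mem k) by apply Hk.
  (* Being uplifting only gives a target at or above the given ordinal; asking for theta + 1 makes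
     it strictly larger than theta. *)
  destruct (H (succ mem HV theta) (ord_succ mem HV theta Ht))
    as [_ [g [Hg [Hle [v [w [Hv [Hw [Hel Hne]]]]]]]]].
  apply (is_V_iff mem HV) in Hv, Hw. destruct Hv as [_ ->], Hw as [Og ->].
  exists g. split; auto. split; [now apply (elementary_proper mem HV)|].
  split; auto. assert (Hs : theta ∈ succ mem HV theta) by (apply in_succ; auto).
  destruct Hle as [Hle|<-]; eauto using Ot.
Qed.

(** Reflection below [g] provides elementary levels V_l without making l inaccessible;
    [elem_cardinal] makes l a cardinal, which is what the pseudo version asks for. *)
Lemma uplifting_restr_pseudo k g (Hkv : k ∈ Vm g) :
  inaccessible mem k -> inaccessible mem g -> elementary mem (Vm k) (Vm g) ->
  pseudo_uplifting (restr mem (Vm g)) (mk (Vm g) Hkv).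
Proof.
  intros Hk Hg Hel. pose proof (inaccessible_limit mem HV g Hg) as Lg.
  pose proof (proj1 Lg) as Og. pose proof (Vh_nice mem HV g Lg) as N.
  assert (Ok : ordinal mem k) by apply Hk.
  assert (Hkg : k ∈ g) by now apply (ord_in_Vh mem HV g k).
  assert (Ik : inaccessible (restr mem (Vm g)) (mk (Vm g) Hkv))
    by now apply (ab_inaccessible _ HV _ _ N).
  split; auto. intros theta Ht. split; auto.
  apply (ab_ordinal _ _ _ _ N) in Ht.
  assert (Htg : proj1_sig theta ∈ g).
  { apply (ord_in_Vh mem HV); auto. apply (proj2_sig theta). }
  destruct (limit_join mem HV g _ _ Lg Hkg Htg) as [e [He [Hke Hte]]].
  destruct (reflect_inaccessible g e Hg He) as [l [Ll [Hel' [Hlg Hell]]]].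
  pose proof (proj1 Ll) as Ol.
  assert (Hlv : l ∈ Vm g) by now apply ord_in_Vh.
  exists (mk (Vm g) Hlv). split.
  - apply (ab_cardinal _ HV _ _ N). simpl. apply (elem_cardinal mem HV l g); auto.
  - split.
    + left. unfold restr. simpl. eauto using Ot.
    + assert (k ∈ l) by eauto using Ot.
      apply proper_elementary_restr; auto. apply elementary_below with g; auto.
Qed.

Lemma uplifting_pseudo k : uplifting mem k -> pseudo_uplifting mem k.
Proof.
  intros [Hk H]. split; auto. intros theta Ht. split; auto.
  destruct (H theta Ht) as [_ [g [Hg K]]]. exists g. split; auto. apply Hg.
Qed.

Lemma uplifting_limit_pseudo k a : uplifting mem k -> a ∈ k ->
  exists m, m ∈ k /\ a ∈ m /\ pseudo_uplifting mem m.
Proof.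
  intros Hup Ha. pose proof (proj1 Hup) as Hk.
  assert (Ok : ordinal mem k) by apply Hk.
  pose proof (inaccessible_limit mem HV k Hk) as Lk.
  pose proof (Vh_nice mem HV k Lk) as Nk.
  destruct (uplifting_above k k Hup Ok) as [g [Hg [Hkg [_ Hel]]]].
  assert (Og : ordinal mem g) by apply Hg.
  assert (Hkv : k ∈ Vm g) by now apply ord_in_Vh.
  assert (Hav : a ∈ Vm k).
  { apply ord_in_Vh; auto. now apply (ord_elem mem HV k). }
  pose proof (uplifting_restr_pseudo k g Hkv Hk Hg Hel) as HP.
  apply (internal_pseudo_uplifting_iff _ (Vh_universe mem HV g Hg)) in HP.
  (* In V_g this statement about [a] is witnessed by [k]; in V_k its witness is an [m] strictly
     between [a] and [k]. *)
  assert (FO : fo (fun D E rho => exists m, E (rho 0) m /\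
    internal_pseudo_uplifting E m)).
  { repeat first [apply fo_internal_pseudo_uplifting | fo_base]. }
  destruct (proj2 (elem_fo mem _ _ _ Hel FO (fun _ => mk (Vm k) Hav)
    (fun _ => mk (Vm g) (proj1 Hel a Hav)) (fun _ => eq_refl))) as [m [Ham Hm]].
  { exists (mk (Vm g) Hkv). split; auto. }
  assert (Im : inaccessible mem (proj1_sig m)).
  { apply (ab_inaccessible _ HV _ _ Nk), Hm. }
  exists (proj1_sig m). split; [|split; [exact Ham|]].
  { apply (ord_in_Vh mem HV k); auto. apply Im. apply (proj2_sig m). }
  split; auto. intros theta Ht. split; auto.
  (* Each theta has its own [g']: V_k is elementary in V_g', so V_g' also regards [m] as pseudo
     uplifting, and the target that it finds at or above theta is genuine by absoluteness. *)
  destruct (uplifting_above k theta Hup Ht) as [g' [Hg' [Hkg' [Htg' Hel']]]].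
  assert (Og' : ordinal mem g') by apply Hg'.
  pose proof (Vh_nice mem HV g' (inaccessible_limit mem HV g' Hg')) as Ng'.
  set (m' := mk (Vm g') (proj1 Hel' _ (proj2_sig m))).
  assert (Hm' : internal_pseudo_uplifting (restr mem (Vm g')) m').
  { apply (elem_fo mem _ _ _ Hel' (fo_internal_pseudo_uplifting 0) (fun _ => m)
      (fun _ => m') (fun _ => eq_refl)). exact Hm. }
  apply (internal_pseudo_uplifting_iff _ (Vh_universe mem HV g' Hg')) in Hm'.
  assert (Htv : theta ∈ Vm g') by now apply ord_in_Vh.
  destruct (proj2 Hm' (mk (Vm g') Htv)) as [_ [l [Hl [Hle HE]]]].
  { now apply (ab_ordinal _ _ _ _ Ng'). }
  exists (proj1_sig l). split; [now apply (ab_cardinal _ HV _ _ Ng')|]. split.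
  - now apply (ab_ord_le _ HV _ _ Ng') in Hle.
  - now apply (proper_elementary_up _ HV _ _ Ng') in HE.
Qed.

(** * Models from a pseudo uplifting cardinal *)

(** In V_k every set x has a successor x ∪ {x}; [elem_valid] extends this to all of V_g, including
    ordinals above [k]. *)
Lemma elementary_limit k g : limit_ordinal mem k -> ordinal mem g -> k ∈ g ->
  elementary mem (Vm k) (Vm g) -> limit_ordinal mem g.
Proof.
  intros Lk Og Hkg Hel. split; [auto|split].
  { intro H. exact (H _ Hkg). }
  pose proof (proj1 Lk) as Ok. pose proof (Vh_nice mem HV k Lk) as Nk.
  intros x Hx. assert (Ox : ordinal mem x) by now apply (ord_elem mem HV g).
  assert (Hxv : x ∈ Vm g) by now apply ord_in_Vh.
  assert (FO : fo (fun D E rho => exists s, is_succ E s (rho 0))).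
  { repeat first [apply fo_succ | fo_base]. }
  assert (Hne : exists z, z ∈ Vm k).
  { apply not_all_not_ex. intro H. destruct Lk as [_ [K _]]. apply K.
    intros z Hz. apply (H z). apply ord_in_Vh; auto. now apply (ord_elem mem HV k). }
  destruct (elem_valid mem _ _ _ Hel Hne FO) with
    (rho := fun _ : nat => mk (Vm g) Hxv) as [[s Hs] Hsx].
  - intro rho. destruct (nice_succ _ _ _ _ Nk (rho 0)) as [s Hs].
    exists s. now apply (ab_succ _ _ _ _ Nk), (is_succ_eq mem HV).
  - assert (Es : is_succ mem s x).
    { intro t. split.
      - intro Ht.
        destruct (proj1 (Hsx (mk (Vm g) (Vh_trans mem HV g s t Og Hs Ht))) Ht)
          as [H|H]; auto. right. now apply (f_equal (@proj1_sig _ _)) in H.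
      - intros [Ht| ->].
        + apply (Hsx (mk (Vm g) (Vh_trans mem HV g x t Og Hxv Ht))). now left.
        + apply (Hsx (mk (Vm g) Hxv)). right. now apply elt_inj. }
    exists s. split; auto. apply (is_succ_eq mem HV) in Es. subst s.
    apply (ord_in_Vh mem HV g); auto. now apply ord_succ.
Qed.

Lemma ZFC_universe_model {D : Type} (E : D -> D -> Prop) :
  ZFC_universe E -> ZFC_model E.
Proof. intros [H1 H2 H3 H4 H5 H6 H7 H8 H9]. constructor; auto. Qed.

(* All axioms but Replacement hold in V_gamma because gamma is a limit;
   Replacement transfers from V_kappa, one formula at a time. *)
Lemma elementary_ZFC k g : inaccessible mem k -> ordinal mem g -> k ∈ g ->
  elementary mem (Vm k) (Vm g) -> ZFC_model (restr mem (Vm g)).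
Proof.
  intros Hk Og Hkg Hel. pose proof (inaccessible_limit mem HV k Hk) as Lk.
  pose proof (elementary_limit k g Lk Og Hkg Hel) as Lg.
  pose proof (inaccessible_omega mem HV k Hk) as Hw.
  assert (Ow : ordinal mem (omega mem HV)) by apply omega_limit.
  assert (Hwk : omega mem HV ∈ Vm k) by (apply ord_in_Vh; auto; apply Lk).
  apply (nice_ZFC mem HV _ _ (Vh_nice mem HV g Lg)).
  { now exists (mk (Vm g) (proj1 Hel _ Hwk)). }
  intros R [f [rho HR]] a Hfun.
  (* The instance of Replacement for [f]: index 0 of [r] holds the set to be mapped, the later ones
     the parameters of [f]. *)
  set (P := fun (D : Type) (E : D -> D -> Prop) (r : nat -> D) =>
    (forall x y z, E x (r 0) -> holds E (scons x (scons y (fun n => r (S n)))) f ->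
       holds E (scons x (scons z (fun n => r (S n)))) f -> y = z) ->
    exists b, forall y, E y b <->
      exists x, E x (r 0) /\ holds E (scons x (scons y (fun n => r (S n)))) f).
  assert (FO : fo P).
  (* Under the binders x, y, z sit at 2, 1, 0 in the functionality hypothesis, and x, y at 0, 1 in
     the conclusion. Each time three binders and the index of the set precede the parameters, which
     start at 4. *)
  { unfold P.
    repeat first
      [ apply fo_holds with
          (r := scons 2 (scons 1 (fun n => S (S (S (S n))))));
        intros D r [|[|n]]; reflexivity
      | apply fo_holds with
          (r := scons 2 (scons 0 (fun n => S (S (S (S n))))));
        intros D r [|[|n]]; reflexivity
      | apply fo_holds with
          (r := scons 0 (scons 1 (fun n => S (S (S (S n))))));
        intros D r [|[|n]]; reflexivity
      | fo_base ]. }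
  assert (HP : P _ (restr mem (Vm g)) (scons a rho)).
  { apply (elem_valid mem _ _ _ Hel (ex_intro _ _ Hwk) FO). intros r Hr.
    apply (ax_replacement _ _ _ (Vh_universe mem HV k Hk)
      (fun x y => holds (restr mem (Vm k))
                    (scons x (scons y (fun n => r (S n)))) f) I).
    exact Hr. }
  destruct HP as [b Hb].
  - intros x y z Hx H1 H2. apply HR in H1, H2. eapply Hfun; eauto.
  - exists b. intro y. rewrite (Hb y).
    split; intros [x [H1 H2]]; exists x; split; auto; revert H2; apply HR.
Qed.

Lemma elementary_Levy k g (Hkv : k ∈ Vm g) : inaccessible mem k -> ordinal mem g ->
  k ∈ g -> elementary mem (Vm k) (Vm g) ->
  Levy_scheme (restr mem (Vm g)) (mk (Vm g) Hkv).
Proof.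
  intros Hk Og Hkg Hel. pose proof (inaccessible_limit mem HV k Hk) as Lk.
  pose proof (elementary_limit k g Lk Og Hkg Hel) as Lg.
  pose proof (Vh_nice mem HV g Lg) as N. pose proof (proj1 Lk) as Ok.
  split; [now apply (ab_inaccessible _ HV _ _ N)|].
  exists (mk (Vm g) (Vh_mono mem HV k g Ok Og Hkg)). split.
  - apply (ab_V _ HV _ _ N). simpl. apply (is_V_iff mem HV). auto.
  - intros f rho Hr. rewrite holds_restr, (nice_sat _ _ _ _ N). simpl.
    symmetry. apply Hel. exact Hr.
Qed.

(* A club of V_kappa extends to a club of V_gamma, of which kappa is a limit
   point, hence a regular element. *)
Lemma elementary_Ord_Mahlo k g : inaccessible mem k -> ordinal mem g -> k ∈ g ->
  elementary mem (Vm k) (Vm g) -> Ord_is_Mahlo (restr mem (Vm k)).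
Proof.
  intros Hk Og Hkg Hel C [f [rho HC]] [C1 [C2 C3]].
  pose proof (inaccessible_limit mem HV k Hk) as Lk.
  pose proof (elementary_limit k g Lk Og Hkg Hel) as Lg.
  pose proof (Vh_nice mem HV g Lg) as Ng. pose proof (Vh_nice mem HV k Lk) as Nk.
  pose proof (proj1 Lk) as Ok.
  set (up := fun x : elt mem (Vm k) => mk (Vm g) (proj1 Hel _ (proj2_sig x))).
  (* Closure of the club moves up to V_g as one statement. That [k] is a limit of it is verified
     with club elements of V_k, whose membership transfers individually. *)
  assert (FO1 : fo (fun D E r => forall l, ordinal E l -> limit_ordinal E l ->
    (forall a, E a l -> exists c, holds E (scons c r) f /\ E a c /\ E c l) ->
    holds E (scons l r) f)).
  { repeat first
      [ apply fo_holds with (r := scons 0 (fun n => S n));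
        intros D r [|n]; reflexivity
      | apply fo_holds with (r := scons 0 (fun n => S (S (S n))));
        intros D r [|n]; reflexivity
      | apply fo_ordinal | apply fo_limit | fo_base ]. }
  assert (FO2 : fo (fun D E r => exists l, holds E (scons l r) f /\
    regular_cardinal E l)).
  { repeat first
      [ apply fo_holds with (r := scons 0 (fun n => S n));
        intros D r [|n]; reflexivity
      | apply fo_regular | fo_base ]. }
  assert (Hkv : k ∈ Vm g) by now apply ord_in_Vh.
  assert (Hfk : holds (restr mem (Vm g))
    (scons (mk (Vm g) Hkv) (fun n => up (rho n))) f).
  { apply (proj1 (elem_fo mem _ _ _ Hel FO1 rho (fun n => up (rho n))
      (fun _ => eq_refl))).
    - intros l Ol Ll Hl. apply HC. apply C3; auto. intros a Ha.
      destruct (Hl a Ha) as [c [H1 H2]]. exists c. split; auto. now apply HC.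
    - now apply (ab_ordinal _ _ _ _ Ng).
    - now apply (ab_limit _ _ _ _ Ng).
    - intros a Ha. unfold restr in Ha. simpl in Ha.
      assert (Oa : ordinal mem (proj1_sig a)) by now apply (ord_elem mem HV k).
      assert (Hak : proj1_sig a ∈ Vm k) by now apply ord_in_Vh.
      destruct (C2 (mk (Vm k) Hak)) as [c [Hc Hac]].
      { now apply (ab_ordinal _ _ _ _ Nk). }
      exists (up c). split; [|split].
      + apply HC in Hc.
        apply (elem_fo mem _ _ (fun D E r => holds E r f) Hel
          (fo_holds f (fun n => n) (fun D r => r) (fun _ _ _ => eq_refl))
          (scons c rho)); [intros [|n]; reflexivity|exact Hc].
      + exact Hac.
      + unfold restr. simpl. apply (ord_in_Vh mem HV k); auto.
        * apply (ab_ordinal _ _ _ _ Nk). auto.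
        * apply (proj2_sig c). }
  destruct (proj2 (elem_fo mem _ _ _ Hel FO2 rho (fun n => up (rho n))
      (fun _ => eq_refl))) as [l [H1 H2]].
  - exists (mk (Vm g) Hkv). split; auto. apply (ab_regular _ HV _ _ Ng). apply Hk.
  - exists l. split; auto. now apply HC.
Qed.

End Uplifting.

Theorem theorem4p2 (V : Type) (mem : V -> V -> Prop) (HV : ZFC_universe mem) :
  (forall d : V, Mahlo mem d ->
     exists vd : V, is_V mem d vd /\
       forall a : V, mem a d ->
         exists k : elt mem vd,
           mem (proj1_sig k) d /\ mem a (proj1_sig k) /\
           uplifting (restr mem vd) k)
  /\
  (forall k : V, uplifting mem k ->
     pseudo_uplifting mem k /\
     forall a : V, mem a k ->
       exists m : V, mem m k /\ mem a m /\ pseudo_uplifting mem m)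
  /\
  ((exists zero k : V, is_empty mem zero /\ pseudo_theta_uplifting mem zero k) ->
     (exists M : V, transitive_set mem M /\ ZFC_model (restr mem M) /\
        exists d : elt mem M, Levy_scheme (restr mem M) d)
     /\
     (exists M : V, transitive_set mem M /\ ZFC_model (restr mem M) /\
        Ord_is_Mahlo (restr mem M))).
Proof.
  split; [|split].
  - intros d Hd. exists (Vh mem HV d). split.
    + apply (is_V_iff mem HV). split; auto. apply Hd.
    + intros a Ha. now apply Mahlo_uplifting.
  - intros k Hk. split; [now apply uplifting_pseudo|].
    intros a Ha. now apply uplifting_limit_pseudo.
  - intros [zero [k [_ [Hk [g [Hg [_ [v [w [Hv [Hw [Hel Hne]]]]]]]]]]]].
    apply (is_V_iff mem HV) in Hv, Hw. destruct Hv as [Ok ->], Hw as [Og ->].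
    assert (Hkg : mem k g) by now apply (elementary_proper mem HV).
    split.
    + exists (Vh mem HV g). split; [|split].
      * intros x y. now apply Vh_trans.
      * now apply elementary_ZFC with k.
      * exists (exist (fun z => mem z (Vh mem HV g)) k
          (proj2 (ord_in_Vh mem HV g k Og Ok) Hkg)).
        now apply elementary_Levy.
    + exists (Vh mem HV k). split; [|split].
      * intros x y. now apply Vh_trans.
      * now apply ZFC_universe_model, Vh_universe.
      * now apply elementary_Ord_Mahlo with g.
Qed.
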